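(* Let $q$ be defined on $(0,a+\delta)$ and $q\in L^1((0,a+\delta))$. Then in any region $\arg(\kappa)\in(-\frac{\pi}{2}+\varepsilon,-\varepsilon)$, $|\kappa|\ge K_0$, we have for all $x\in[0,a]$ that $$|m(-\kappa^2,x)+\kappa|\le C_{\varepsilon,\delta},$$ where $C_{\varepsilon,\delta}$ depends only on $\varepsilon,\delta$ and $\sup_{0\le x\le a}\left(\int_x^{x+\delta}|q(y)|\,dy\right)$.
   Context: Here $a,\delta,\varepsilon>0$, and $K_0$ is a positive constant (the source does not specify it further). The function $m(z,x)$ is the $m$-function of a problem on an interval $(0,b)$ with $b\ge a+\delta$, where $q$ is real-valued on $(0,b)$ and, with a boundary condition at $b$ where applicable, one of the following holds. Case 1: $b<\infty$, $q\in L^1((0,b))$, and a parameter $h\in\mathbb R\cup\{\infty\}$ is fixed, giving the boundary condition $u'(b_-)+hu(b_-)=0$ (with $h=\infty$ meaning $u(b_-)=0$). In Cases 2–4, $b=\infty$ and $\int_0^R|q(x)|\,dx<\infty$ for all $R<\infty$. Case 2: $\sup_{R>0}\int_R^{R+1}\max(-q(x),0)\,dx<\infty$. Case 3: the condition of Case 2 fails, but $-\frac{d^2}{dx^2}+q$ is limit point at $\infty$, i.e. for each $z$ with $\operatorname{Im}z>0$ the equation $-u''+qu=zu$ has a solution, unique up to a multiplicative constant, that is $L^2$ at $\infty$. Case 4: $-\frac{d^2}{dx^2}+q$ is limit circle at $\infty$, i.e. every solution of $-u''+qu=zu$ is $L^2$ at $\infty$ if $\operatorname{Im} z>0$; a boundary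 condition at infinity is picked by picking a nonzero solution $u_0$ of $-u''+qu=iu$, and a function $u$ satisfies the boundary condition if $\lim_{x\to\infty}[u_0(x)u'(x)-u_0'(x)u(x)]=0$. For $\operatorname{Im}z>0$ let $u(x,z)$ be a nonzero solution of $-u''+qu=zu$ satisfying the boundary condition at $b$ (in Cases 2, 3: square integrable near $\infty$), and define $m(z,x)=u'(x,z)/u(x,z)$ (at $x=0$ the value is the limit $x\downarrow0$).
   Formalization: In Case 4 the solution u_0 is also required to satisfy lim Im(conj(u_0) u_0') >= 0 at infinity (selfadjoint or dissipative condition); for arbitrary nonzero u_0 the bound fails, since m(z,x) can have a pole at a point of (0,a). *)

(* Defs.v *)
From HB Require Import structures.
From mathcomp Require Import all_boot all_order all_algebra.
From mathcomp Require Import all_classical all_reals all_analysis.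
From mathcomp Require Import complex.

Set Implicit Arguments.
Unset Strict Implicit.
Unset Printing Implicit Defensive.

Import Order.TTheory GRing.Theory Num.Theory.
Import numFieldNormedType.Exports.
Import ComplexField.Normc.

Local Open Scope classical_set_scope.
Local Open Scope ring_scope.
Local Open Scope complex_scope.

Section schroedinger.
Context {R : realType}.
Local Notation mu := (@lebesgue_measure R).
Local Notation Re := complex.Re.
Local Notation Im := complex.Im.

(* The real-closed library puts no topology on [R[i]], so limits and
   derivatives of complex-valued functions are taken componentwise. *)
Definition cvgC (f : R -> R[i]) (F : set_system R) (l : R[i]) : Prop :=
  ((fun x => Re (f x)) @ F --> Re l) /\
  ((fun x => Im (f x)) @ F --> Im l).

Definition derivableC (f : R -> R[i]) (x : R) : Prop :=
  derivable (fun t => Re (f t)) x 1 /\ derivable (fun t => Im (f t)) x 1.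

Definition deriveC (f : R -> R[i]) (x : R) : R[i] :=
  derive1 (fun t => Re (f t)) x +i* derive1 (fun t => Im (f t)) x.

(* The principal argument. *)
Definition is_arg (z : R[i]) (theta : R) : Prop :=
  [/\ z != 0, - pi < theta <= pi &
      z = (normc z * cos theta) +i* (normc z * sin theta)].

Definition abs_continuousC (c d : R) (f : R -> R[i]) : Prop :=
  forall e : R, 0 < e -> exists2 eta : R, 0 < eta &
    forall (n : nat) (s t : 'I_n -> R),
      (forall i, [/\ c <= s i, s i <= t i & t i <= d]) ->
      (forall i j, i != j -> t i <= s j \/ t j <= s i) ->
      \sum_(i < n) (t i - s i) < eta ->
      \sum_(i < n) normc (f (t i) - f (s i)) < e.

Definition in_itv0 (b : \bar R) (x : R) : Prop := 0 < x /\ (x%:E < b)%E.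

(* Solutions of [- u'' + q u = z u] on (0, b) in the sense usual for locally
   integrable [q]: [u] is differentiable, [u'] is locally absolutely continuous
   and the equation holds almost everywhere. *)
Definition solves (q : R -> R) (b : \bar R) (z : R[i]) (u : R -> R[i]) : Prop :=
  [/\ forall x, in_itv0 b x -> derivableC u x,
      forall c d, in_itv0 b c -> in_itv0 b d -> abs_continuousC c d (deriveC u) &
      {ae mu, forall x, in_itv0 b x ->
         derivableC (deriveC u) x /\
         - deriveC (deriveC u) x + (q x)%:C * u x = z * u x}].

Definition nonzero_on (b : \bar R) (u : R -> R[i]) : Prop :=
  exists2 x, in_itv0 b x & u x != 0.

Definition L2_at_infty (u : R -> R[i]) : Prop :=
  exists2 r : R, 0 < r &
    mu.-integrable `[r, +oo[ (fun x => (normc (u x) ^+ 2)%:E).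

Definition limit_point (q : R -> R) : Prop :=
  forall z : R[i], 0 < Im z ->
    exists u, [/\ solves q +oo%E z u, nonzero_on +oo%E u, L2_at_infty u &
      forall v, solves q +oo%E z v -> L2_at_infty v ->
        exists c : R[i], forall x, 0 < x -> v x = c * u x].

Definition limit_circle (q : R -> R) : Prop :=
  forall z : R[i], 0 < Im z -> forall u, solves q +oo%E z u -> L2_at_infty u.

Definition neg_part_unif_integrable (q : R -> R) : Prop :=
  (ereal_sup [set \int[mu]_(x in `]r, (r + 1)%R[) (Num.max (- q x) 0%R)%:E
             | r in `]0%R, +oo[%classic] < +oo)%E.

(* [Finite_end b h]: the interval (0, b), with [u'(b-) + h u(b-) = 0] for
   [h = Some _] and [u(b-) = 0] for [h = None] (that is, h = infinity).
   The other three constructors have b = +oo; [u0] fixes the boundary condition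
   in the limit circle case. *)
Inductive endpoint : Type :=
| Finite_end of R & option R
| Neg_part_end
| Limit_point_end
| Limit_circle_end of (R -> R[i]).

Definition right_end (e : endpoint) : \bar R :=
  if e is Finite_end b _ then b%:E else +oo%E.

Definition integrable_to (q : R -> R) (r : R) : Prop :=
  mu.-integrable `]0, r[ (EFin \o q).

Definition loc_integrable (q : R -> R) : Prop :=
  forall r : R, 0 < r -> integrable_to q r.

(* An arbitrary nonzero solution [u0] of [- u0'' + q u0 = i u0] does not give
   an m-function: [m(i, x) = u0'(x) / u0(x)] could be anything, including a
   pole. Here [Im (conj u0 * u0')] has derivative [- |u0|^2], and its limit at
   infinity is 0 exactly when the boundary condition given by [u0] is
   selfadjoint. Requiring the limit to be nonnegative contains the selfadjoint
   conditions and keeps [m(z, x)] Herglotz; for any given [z] in the upper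
   half-plane and [x], some [u0] with a negative limit gives a pole there. *)
Definition dissipative_at_infty (u0 : R -> R[i]) : Prop :=
  exists2 l : R, 0 <= l &
    (fun x => Im (conjc (u0 x) * deriveC u0 x)) @ +oo --> l.

Definition admissible (q : R -> R) (e : endpoint) : Prop :=
  match e with
  | Finite_end b _ => 0 < b /\ integrable_to q b
  | Neg_part_end => loc_integrable q /\ neg_part_unif_integrable q
  | Limit_point_end =>
      [/\ loc_integrable q, ~ neg_part_unif_integrable q & limit_point q]
  | Limit_circle_end u0 =>
      [/\ loc_integrable q, limit_circle q, solves q +oo%E 'i u0,
          nonzero_on +oo%E u0 & dissipative_at_infty u0]
  end.

Definition boundary_condition (e : endpoint) (u : R -> R[i]) : Prop :=
  match e with
  | Finite_end b h =>
      exists ub ub' : R[i],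
        [/\ cvgC u (b^'-) ub, cvgC (deriveC u) (b^'-) ub' &
            if h is Some h then ub' + h%:C * ub = 0 else ub = 0]
  | Neg_part_end | Limit_point_end => L2_at_infty u
  | Limit_circle_end u0 =>
      cvgC (fun x => u0 x * deriveC u x - deriveC u0 x * u x) +oo 0
  end.

Definition is_m_function (q : R -> R) (e : endpoint) (m : R[i] -> R -> R[i]) :
    Prop :=
  forall z : R[i], 0 < Im z ->
    exists u, [/\ solves q (right_end e) z u, nonzero_on (right_end e) u,
      boundary_condition e u,
      forall x, in_itv0 (right_end e) x -> m z x = deriveC u x / u x &
      cvgC (m z) (0^'+) (m z 0)].

Definition window_sup (q : R -> R) (a delta : R) : R :=
  sup [set (\int[mu]_(y in `]x, (x + delta)[) `|q y|)%R | x in `[0, a]%classic].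

End schroedinger.

Arguments endpoint : clear implicits.

(* Main.v *)
(* Fix z = -kappa^2 and let u be the solution defining m(z, .). The flux
   W = Im (conj u u') satisfies W' = - Im z |u|^2, so it decreases; in each of
   the four cases the condition at the right end point b forces lim W >= 0 at b.
   Hence W > 0 on (0, b), that is, m = u'/u lies in the upper half-plane.

   What remains uses only q on [x, x + delta/2]. The reflection coefficient
   Gamma = (m + kappa) / (m - kappa) satisfies
     Gamma' = 2 kappa Gamma - q (Gamma - 1)^2 / (2 kappa)
   and is bounded, since m is in the upper half-plane and kappa in the fourth
   quadrant. As Re kappa >= sin(eps) |kappa|, going back from x + delta/2 to x
   gives |Gamma(x)| <= A / |kappa| with A depending on the data allowed. If
   |kappa| >= 2A, then |Gamma| <= 1/2 and
   |m + kappa| = 2 |kappa Gamma / (1 - Gamma)| <= 4A. If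
   K0 <= |kappa| <= 2A, then m(x) is bounded: normalise u'(x) = 1; were
   u(x) = 1/m(x) small, |u| would grow to the right of x and
   |u(x)| >= W(x) >= Im z \int |u|^2 would bound it from below. *)
Require Import Defs.
From HB Require Import structures.
From mathcomp Require Import all_boot all_order all_algebra.
From mathcomp Require Import all_classical all_reals all_analysis.
From mathcomp Require Import measurable_realfun.
From mathcomp Require Import complex.
From mathcomp Require Import ring lra.
Set Implicit Arguments.
Unset Strict Implicit.
Unset Printing Implicit Defensive.
Import Order.TTheory GRing.Theory Num.Theory.
Import numFieldNormedType.Exports.
Import ComplexField.Normc.
Local Open Scope classical_set_scope.
Local Open Scope ring_scope.
Local Open Scope complex_scope.

(** * Absolute continuity and monotonicity *)

(** Since [q] is only integrable, u' is merely absolutely continuous. Hence every estimate is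
    phrased as the monotonicity of an absolutely continuous function whose derivative has a sign
    almost everywhere; integrals enter as primitives added to that function. The sign of lim W has
    four sources. At a finite end, a real h makes W tend to 0. If the negative part of [q] is
    uniformly locally integrable, a negative value of W would force a fixed loss of W on every later
    unit interval, although W is bounded below for a square integrable u. In the limit point case a
    negative value would produce a second, independent square integrable solution. In the limit
    circle case a Pluecker relation between Wronskians would make a negative W tend to 0, although
    it decreases. Half of the window is used because x + delta may be the end point b itself.
    Moderate |kappa| needs its own argument because Gamma may then be close to 1, where m, as a
    function of Gamma, has its pole. *)

Section absolute_continuity.
Context {R : realType}.
Local Notation mu := (@lebesgue_measure R).
Implicit Types (f g : R -> R) (c d x : R).

Definition ac c d f : Prop :=
  forall e : R, 0 < e -> exists2 eta : R, 0 < eta &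
    forall (n : nat) (s t : 'I_n -> R),
      (forall i, [/\ c <= s i, s i <= t i & t i <= d]) ->
      (forall i j, i != j -> t i <= s j \/ t j <= s i) ->
      \sum_(i < n) (t i - s i) < eta ->
      \sum_(i < n) `|f (t i) - f (s i)| < e.

(** The chains in [ac_nincr] grow to the right by consing, which suits lists ordered from right to
    left better than indexed families. *)
Lemma ac_seq c d f e : ac c d f -> 0 < e -> exists2 eta, 0 < eta &
  forall l : seq (R * R),
    {in l, forall p, [/\ c <= p.1, p.1 <= p.2 & p.2 <= d]} ->
    pairwise (fun p q => q.2 <= p.1) l ->
    \sum_(p <- l) (p.2 - p.1) < eta ->
    \sum_(p <- l) `|f p.2 - f p.1| < e.
Proof.
move=> acf e0; have [eta eta0 H] := acf e e0; exists eta => // l lcd lpw.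
rewrite !(big_nth (0, 0)) !big_mkord => ls.
apply: (H (size l) (fun i => (nth (0, 0) l i).1)
                   (fun i => (nth (0, 0) l i).2)) => //.
  by move=> i; apply: lcd; exact: mem_nth.
move=> i j ij; have [ltij|ltji|/val_inj eij] := ltngtP i j.
- by right; apply: (pairwiseP _ lpw); rewrite ?inE.
- by left; apply: (pairwiseP _ lpw); rewrite ?inE.
- by rewrite eij eqxx in ij.
Qed.

(** The increment is split at x; both difference quotients based at x are at most l + e <= e. *)
Lemma straddle f x l e : is_derive x 1 f l -> l <= 0 -> 0 < e ->
  exists2 r, 0 < r & forall s t, x - r < s -> s <= x -> x <= t -> t < x + r ->
    f t - f s <= e * (t - s).
Proof.
move=> fl l0 e0.
have fx : derivable f x 1 by exact: ex_derive.
have fxl : h^-1 *: (f (h *: (1:R) + x) - f x) @[h --> 0^'] --> l.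
  by rewrite -(@derive_val _ _ _ _ _ _ _ fl); exact: fx.
have /cvgrPdist_le/(_ _ e0) := fxl.
rewrite near_withinE => -[r /= r0 H]; exists r => //.
have K (h : R) : `|h| < r -> h != 0 -> h^-1 * (f (h + x) - f x) <= e.
  move=> hr h0; have := H h; rewrite /= sub0r normrN => /(_ hr h0).
  rewrite /GRing.scale/= mulr1.
  set y := _ * _ => /= ly; have : y - l <= `|l - y| by rewrite distrC ler_norm.
  lra.
have Kr t : x <= t -> t < x + r -> f t - f x <= e * (t - x).
  rewrite le_eqVlt => /predU1P[<-|xt] tr; first by rewrite !subrr mulr0.
  have := K (t - x); rewrite subrK ger0_norm ?subr_ge0 ?(ltW xt)//.
  have -> : t - x < r by rewrite ltrBlDl.
  rewrite subr_eq0 gt_eqF// => /(_ isT isT).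
  by rewrite mulrC ler_pdivrMr ?subr_gt0.
have Kl s : s <= x -> x - r < s -> f x - f s <= e * (x - s).
  rewrite le_eqVlt => /predU1P[->|xt] tr; first by rewrite !subrr mulr0.
  have := K (s - x); rewrite subrK ler0_norm ?subr_le0 ?(ltW xt)//.
  have -> : - (s - x) < r by lra.
  rewrite subr_eq0 lt_eqF// => /(_ isT isT).
  rewrite -[s - x]opprB invrN mulNr -mulrN opprB mulrC.
  by rewrite ler_pdivrMr ?subr_gt0.
move=> s t s1 s2 t1 t2; have := Kl s s2 s1; have := Kr t t1 t2; lra.
Qed.

(* Outside a null set covered by a small open set [U] the increments of [f] are
   controlled by the derivative; those over intervals inside [U] are controlled
   by absolute continuity. A supremum argument plays the role of Cousin's
   lemma. *)
Lemma ac_nincr c d f : c <= d -> ac c d f ->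
  {ae mu, forall x, c < x < d -> exists2 l, is_derive x 1 f l & l <= 0} ->
  f d <= f c.
Proof.
move=> cd acf aef.
suff H e : 0 < e -> f d - f c <= e * (d - c) + e.
  rewrite leNgt; apply/negP => fcd.
  (* With this choice e * (d - c + 1) is half of f d - f c. *)
  pose e := (f d - f c) / (2 * (d - c + 1)).
  have dc0 : 0 < d - c + 1 by lra.
  have e0 : 0 < e by rewrite divr_gt0 ?mulr_gt0// subr_gt0.
  have := H e e0; have : e * (2 * (d - c + 1)) = f d - f c.
    by rewrite divfK// gt_eqF// mulr_gt0.
  nra.
move=> e0; have [eta eta0 acl] := ac_seq acf e0.
pose N := ~` [set x | c < x < d -> exists2 l, is_derive x 1 f l & l <= 0].
(* Nothing is assumed about the derivative at the end points, so they join the exceptional set. *)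
have N0 : mu.-negligible (N `|` [set c; d]).
  apply: negligibleU => //; apply/negligibleP.
    by apply: measurableU.
  exact/countable_lebesgue_measure0/finite_set_countable/finite_set2.
have eta20 : 0 < eta / 2 by rewrite divr_gt0.
have [U [oU NU muU]] := outer_measure_open_le (N `|` [set c; d]) eta20.
have mU : measurable U by exact: open_measurable.
rewrite (negligible_outer_measure _).1// add0e in muU.
(* The intervals inside [U] are recorded rather than estimated one at a time, so that absolute
   continuity is applied only once, to all of them together. *)
pose chain t := exists l : seq (R * R),
  [/\ {in l, forall p, [/\ c <= p.1, p.1 <= p.2 & p.2 <= t]},
      pairwise (fun p q => q.2 <= p.1) l,
      ((\sum_(p <- l) (p.2 - p.1))%:E <= mu (U `&` `]c, t]))%E &
      f t - f c <= e * (t - c) + \sum_(p <- l) `|f p.2 - f p.1| ].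
have chain_c : chain c.
  exists [::]; rewrite !big_nil; split => //.
  by rewrite !subrr mulr0 addr0.
have good s t : chain s -> s <= t -> f t - f s <= e * (t - s) -> chain t.
  move=> [l [l1 l2 l3 l4]] st fst; exists l; split => //.
  - by move=> p /l1[? ? ps]; split => //; exact: le_trans st.
  - apply: (le_trans l3); apply: le_measure; rewrite ?inE.
    + exact: measurableI.
    + exact: measurableI.
    + by apply: setIS; apply: subset_itvl; rewrite bnd_simp.
  - lra.
have bad s t : chain s -> c <= s -> s <= t -> `]s, t] `<=` U -> chain t.
  move=> [l [l1 l2 l3 l4]] cs st stU; exists ((s, t) :: l); split => //=.
  - move=> p; rewrite inE => /predU1P[->//|/l1[? ? ps]].
    by split => //; exact: le_trans st.
  - by rewrite l2 andbT; apply/allP => p /l1[].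
  - rewrite big_cons/= EFinD.
    rewrite (_ : U `&` `]c, t] = `]s, t] `|` (U `&` `]c, s])).
      rewrite measureU//.
      + apply: leeD => //; rewrite [leRHS](@lebesgue_measure_itv R `]s, t])/=
        lte_fin EFinD EFinN.
        by case: ltP => //; rewrite -EFinD lee_fin subr_le0.
      + exact: measurableI.
      + apply/seteqP; split => x //= [] /=; rewrite !in_itv/=.
        by move=> /andP[sx _] [_ /andP[_]]; rewrite leNgt sx.
    apply/seteqP; split => x /=.
      rewrite !in_itv/= => -[Ux /andP[cx xt]]; rewrite xt andbT.
      by have [|] := leP x s; [right; rewrite cx|left].
    move=> [xst|[Ux]]; rewrite !in_itv/=.
      split; first exact: stU.
      by move: xst; rewrite in_itv/= => /andP[sx ->]; rewrite (le_lt_trans cs).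
    by move=> /andP[-> xs]; rewrite (le_trans xs st).
  - rewrite big_cons/=; have := ler_norm (f t - f s).
    have : 0 <= e * (t - s) by rewrite mulr_ge0 ?subr_ge0 ?(ltW e0).
    lra.
have step x : c <= x <= d -> exists2 r, 0 < r &
    forall s t, c <= s -> t <= d -> x - r < s -> s <= x -> x <= t ->
      t < x + r -> chain s -> chain t.
  move=> /andP[cx xd].
  have [xN|/not_orP[xN xcd]] := pselect ((N `|` [set c; d]) x).
    have [r /= r0 rU] := oU _ (NU _ xN).
    exists r => // s t cs td sr sx xt tr chs; apply: bad chs _ _ _ => //.
      exact: le_trans xt.
    move=> y /=; rewrite in_itv/= => /andP[sy yt]; apply: rU => /=.
    by rewrite ltr_distlC; apply/andP; split; lra.
  move/contrapT: xN => []; rewrite /=.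
    rewrite !lt_neqAle cx xd !andbT.
    by apply/andP; split; apply/eqP => xE; apply: xcd; [left|right].
  move=> l fl l0; have [r r0 H] := straddle fl l0 e0.
  exists r => // s t cs td sr sx xt tr chs; apply: good chs _ _ => //.
    exact: le_trans xt.
  exact: H.
pose T := [set t | c <= t <= d /\ chain t].
have Tc : T c by split; rewrite ?lexx.
have hsT : has_sup T.
  by split; [exists c|exists d => t [/andP[]]].
have supcd : c <= sup T <= d.
  apply/andP; split; first by apply: ub_le_sup; [case: hsT|].
  by apply: ge_sup; [exists c|move=> t [/andP[]]].
have [r r0 H] := step _ supcd.
have [s [/andP[cs sd] chs] sr] := sup_adherent r0 hsT.
have ssup : s <= sup T.
  by apply: ub_le_sup; [case: hsT|split => //; rewrite cs].
have chd : chain d.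
  (* Either [d] is within reach of the supremum, or [sup T + r / 2] belongs to [T], which is
     absurd. *)
  have [dr|dr] := ltP d (sup T + r / 2).
    have := H s d cs (lexx _) sr ssup; apply => //; first by case/andP: supcd.
    lra.
  have : T (sup T + r / 2).
    split; first by apply/andP; split => //; lra.
    apply: (H s) => //; lra.
  by move=> /(ub_le_sup hsT.2); lra.
have [l [l1 l2 l3 l4]] := chd.
have : \sum_(p <- l) `|f p.2 - f p.1| < e.
  apply: acl => //.
  suff : \sum_(p <- l) (p.2 - p.1) <= eta / 2 by lra.
  rewrite -lee_fin; apply: le_trans l3 _; apply: le_trans muU.
  by apply: le_measure; rewrite ?inE//; exact: measurableI.
lra.
Qed.

End absolute_continuity.

(** * Calculus of absolutely continuous functions and their derivatives *)

Section ac_derivatives.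
Context {R : realType}.
Local Notation mu := (@lebesgue_measure R).
Implicit Types (f g h : R -> R) (a b c d x : R).

Lemma ac_sub c d c' d' f : c <= c' -> d' <= d -> ac c d f -> ac c' d' f.
Proof.
move=> cc dd acf e /acf[eta eta0 H]; exists eta => // n s t st; apply: H.
by move=> i; have [? ? ?] := st i; split => //;
  [exact: le_trans cc _|exact: le_trans dd].
Qed.

(** The closure properties below reduce to this domination of increments. In the proof e is divided
    by 2 (M + 1), as M may be 0. *)
Lemma ac_dom c d f g h M : 0 <= M ->
  (forall s t, c <= s -> s <= t -> t <= d ->
    `|h t - h s| <= M * (`|f t - f s| + `|g t - g s|)) ->
  ac c d f -> ac c d g -> ac c d h.
Proof.
move=> M0 H acf acg e e0.
have e'0 : 0 < e / (2 * (M + 1)) by rewrite divr_gt0// mulr_gt0// ltr_wpDl.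
have [e1 e10 H1] := acf _ e'0; have [e2 e20 H2] := acg _ e'0.
exists (Num.min e1 e2); first by rewrite lt_min e10.
move=> n s t st dst; rewrite lt_min => /andP[/(H1 _ _ _ st dst) {}H1].
move=> /(H2 _ _ _ st dst) {}H2.
set S1 := \sum_(i < n) `|f (t i) - f (s i)| in H1.
set S2 := \sum_(i < n) `|g (t i) - g (s i)| in H2.
apply: (@le_lt_trans _ _ (M * (S1 + S2))).
  rewrite -big_split mulr_sumr; apply: ler_sum => i _.
  by have [? ? ?] := st i; exact: H.
have S10 : 0 <= S1 by apply: sumr_ge0.
have S20 : 0 <= S2 by apply: sumr_ge0.
have : e / (2 * (M + 1)) * (2 * (M + 1)) = e.
  by rewrite divfK// gt_eqF// mulr_gt0// ltr_wpDl.
nra.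
Qed.

Lemma ac_dom1 c d f h M : 0 <= M ->
  (forall s t, c <= s -> s <= t -> t <= d -> `|h t - h s| <= M * `|f t - f s|) ->
  ac c d f -> ac c d h.
Proof.
move=> M0 H acf; apply: (ac_dom M0 _ acf acf) => s t cs st td.
by rewrite (le_trans (H _ _ cs st td))// ler_wpM2l// lerDl.
Qed.

Lemma ac_id c d : ac c d id.
Proof.
move=> e e0; exists e => // n s t st _; apply: le_lt_trans.
by apply: ler_sum => i _; have [_ ? _] := st i; rewrite ger0_norm// subr_ge0.
Qed.

Lemma ac_continuous c d f : ac c d f -> {within `[c, d], continuous f}.
Proof.
move=> acf; apply/subspace_continuousP => x /=; rewrite in_itv/= => /andP[cx xd].
apply/cvgrPdist_lt => e /acf[eta eta0 H]; rewrite near_withinE.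
near=> y; rewrite /= in_itv/= => /andP[cy yd].
have xy : `|x - y| < eta by near: y; exact: nbhsx_ballx.
have := H 1%N (fun=> Num.min x y) (fun=> Num.max x y).
rewrite !big_ord1.
have -> : `|f x - f y| = `|f (Num.max x y) - f (Num.min x y)|.
  by case: (leP x y) => // _; rewrite distrC.
apply; last first.
- move: xy; case: (leP x y) => yx; rewrite ?(distrC x).
 by rewrite ger0_norm// subr_ge0.
  by rewrite distrC ger0_norm// subr_ge0 ltW.
- by move=> i j; rewrite !ord1 eqxx.
- by move=> _; rewrite le_min ge_max cx cy xd yd ge_min le_max lexx/=; split.
Unshelve. all: by end_near. Qed.

Lemma ac_bounded c d f : ac c d f ->
  exists2 M, 0 < M & forall x, c <= x -> x <= d -> `|f x| <= M.
Proof.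
move=> acf; have [cd|dc] := leP c d; last first.
  by exists 1 => // x cx /(le_trans cx); rewrite leNgt dc.
have acn : ac c d (fun x => `|f x|).
  apply: (@ac_dom1 _ _ f _ 1) acf => // s t _ _ _; rewrite mul1r.
  exact: ler_dist_dist.
have [x0 _ H] := EVT_max cd (ac_continuous acn).
exists (`|f x0| + 1) => [|x cx xd]; first by rewrite ltr_wpDl.
by rewrite (le_trans (H x _)) ?in_itv/= ?cx// lerDl.
Qed.

Lemma ac_gt0_bounded c d f : ac c d f ->
  (forall x, c <= x -> x <= d -> 0 < f x) ->
  exists2 m, 0 < m & forall x, c <= x -> x <= d -> m <= f x.
Proof.
move=> acf f0; have [cd|dc] := leP c d; last first.
  by exists 1 => // x cx /(le_trans cx); rewrite leNgt dc.
have [x0 + H] := EVT_min cd (ac_continuous acf).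
rewrite in_itv/= => /andP[cx0 x0d]; exists (f x0) => [|x cx xd]; first exact: f0.
by rewrite H// in_itv/= cx.
Qed.

(* [f'] is a derivative of [f] almost everywhere only; its other values are
   irrelevant. *)
Definition acd c d f f' : Prop :=
  ac c d f /\ {ae mu, forall x, c < x < d -> is_derive x 1 f (f' x)}.

Lemma ae_imply (P Q : R -> Prop) : (forall x, P x -> Q x) ->
  {ae mu, forall x, P x} -> {ae mu, forall x, Q x}.
Proof.
move=> PQ; exact: (@filterS _ _ (ae_filter_ringOfSetsType mu) _ _ PQ).
Qed.

Lemma ae_imply2 (P Q S : R -> Prop) : (forall x, P x -> Q x -> S x) ->
  {ae mu, forall x, P x} -> {ae mu, forall x, Q x} -> {ae mu, forall x, S x}.
Proof.
move=> PQS; exact: (@filterS2 _ _ (ae_filter_ringOfSetsType mu) _ _ _ PQS).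
Qed.

Lemma acd_sub c d c' d' f f' : c <= c' -> d' <= d -> acd c d f f' -> acd c' d' f f'.
Proof.
move=> cc dd [acf df]; split; first exact: ac_sub acf.
apply: ae_imply df => x H /andP[cx xd]; apply: H.
by rewrite (le_lt_trans cc)//= (lt_le_trans xd).
Qed.

Lemma acd_ae_eq c d f f' g : acd c d f f' ->
  {ae mu, forall x, c < x < d -> f' x = g x} -> acd c d f g.
Proof.
move=> [acf df] H; split => //; apply: ae_imply2 df H => x H1 H2 xcd.
by rewrite -H2//; exact: H1.
Qed.

Lemma acd_eq c d f f' g : acd c d f f' ->
  (forall x, c < x < d -> f' x = g x) -> acd c d f g.
Proof. by move=> H1 H2; apply: (acd_ae_eq H1); exact: aeW. Qed.

Lemma acd_cst c d (k : R) : acd c d (fun=> k) (fun=> 0).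
Proof.
split; last by apply: aeW => x _; exact: is_derive_cst.
apply: (@ac_dom1 _ _ id _ 0) => // [s t _ _ _|]; last exact: ac_id.
by rewrite subrr normr0 mul0r.
Qed.

Lemma acd_id c d : acd c d id (fun=> 1).
Proof. by split; [exact: ac_id|apply: aeW => x _; exact: is_derive_id]. Qed.

Lemma acdD c d f f' g g' : acd c d f f' -> acd c d g g' ->
  acd c d (fun x => f x + g x) (fun x => f' x + g' x).
Proof.
move=> [acf df] [acg dg]; split; last first.
  by apply: ae_imply2 df dg => x H1 H2 xcd; exact: (is_deriveD (H1 xcd) (H2 xcd)).
apply: (@ac_dom _ _ f g _ 1) => // s t _ _ _; rewrite mul1r.
by rewrite opprD addrACA ler_normD.
Qed.

Lemma acdM c d f f' g g' : acd c d f f' -> acd c d g g' ->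
  acd c d (fun x => f x * g x) (fun x => f' x * g x + f x * g' x).
Proof.
move=> [acf df] [acg dg]; split; last first.
  apply: ae_imply2 df dg => x H1 H2 xcd.
  apply: (is_derive_eq (is_deriveM (H1 xcd) (H2 xcd))).
  by rewrite /GRing.scale/= addrC [g x * _]mulrC.
have [M M0 fM] := ac_bounded acf; have [N N0 gN] := ac_bounded acg.
apply: (@ac_dom _ _ f g _ (M + N)) => [|s t cs st td||]//.
  by rewrite addr_ge0// ltW.
rewrite (_ : _ - _ = (f t - f s) * g t + f s * (g t - g s)); last by ring.
rewrite (le_trans (ler_normD _ _))// !normrM.
have := gN t (le_trans cs st) td; have := fM s cs (le_trans st td).
have := normr_ge0 (f t - f s); have := normr_ge0 (g t - g s).
set x1 := `|f t - _|; set x2 := `|g t - _|.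
have := normr_ge0 (g t); have := normr_ge0 (f s).
nra.
Qed.

Lemma acdN c d f f' : acd c d f f' -> acd c d (fun x => - f x) (fun x => - f' x).
Proof.
move=> fd; have := acdM (acd_cst c d (-1)) fd.
rewrite (_ : (fun x => -1 * f x) = (fun x => - f x)); last first.
  by apply/funext => x; rewrite mulN1r.
by move/acd_eq; apply => x _; rewrite mul0r add0r mulN1r.
Qed.

Lemma acdB c d f f' g g' : acd c d f f' -> acd c d g g' ->
  acd c d (fun x => f x - g x) (fun x => f' x - g' x).
Proof. by move=> fd /acdN; exact: acdD. Qed.

Lemma acdZ c d k f f' : acd c d f f' -> acd c d (fun x => k * f x) (fun x => k
  * f' x).
Proof.
move=> /(acdM (acd_cst c d k)) /acd_eq; apply => x _.
by rewrite mul0r add0r.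
Qed.

Lemma acdV c d f f' : (forall x, c <= x -> x <= d -> 0 < f x) -> acd c d f f' ->
  acd c d (fun x => (f x)^-1) (fun x => - f' x / f x ^+ 2).
Proof.
move=> f0 [acf df]; split; last first.
  apply: ae_imply df => x H xcd.
  have fx0 : f x != 0.
    by rewrite gt_eqF// f0//; case/andP: xcd => *; exact: ltW.
  have fx := H xcd.
  have dfx : derivable f x 1 by exact: ex_derive.
  apply: DeriveDef; first exact: derivableV.
  by rewrite deriveV// derive_val /GRing.scale/= mulNr mulrC mulNr.
have [m m0 fm] := ac_gt0_bounded acf f0.
apply: (@ac_dom1 _ _ f _ (m^-1 * m^-1)) acf => [|s t cs st td].
  by rewrite mulr_ge0// invr_ge0 ltW.
have fs := f0 s cs (le_trans st td); have ft := f0 t (le_trans cs st) td.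
have -> : (f t)^-1 - (f s)^-1 = (f t)^-1 * (f s)^-1 * (f s - f t).
  by field; rewrite !gt_eqF.
rewrite normrM distrC ler_wpM2r// normrM !gtr0_norm ?invr_gt0//.
apply: ler_pM; rewrite ?invr_ge0 ?(ltW fs) ?(ltW ft)//.
- by rewrite lef_pV2 ?posrE// fm// (le_trans cs).
- by rewrite lef_pV2 ?posrE// fm// (le_trans st).
Qed.

(** The mean value theorem makes f Lipschitz. This serves for u, which, unlike u', is differentiable
    everywhere. *)
Lemma acd_C1 c d f f' M :
  (forall x, c <= x -> x <= d -> is_derive x 1 f (f' x)) ->
  (forall x, c <= x -> x <= d -> `|f' x| <= M) ->
  acd c d f f'.
Proof.
move=> df fM; split; last first.
  by apply: aeW => x /andP[cx xd]; apply: df; exact: ltW.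
have [cd|dc] := ltP d c.
  (* If d < c, only the empty family of intervals is admissible. *)
  move=> e e0; exists 1 => // -[|n] s t st _ _; first by rewrite big_ord0.
  have [cs st' td] := st ord0.
  by move: cd; rewrite ltNge (le_trans cs)// (le_trans st').
have M0 : 0 <= M by apply: le_trans (fM c _ _).
apply: (@ac_dom1 _ _ id _ M) (ac_id _ _) => // s t cs st td.
have [||x /itvP xst ->] := @MVT_segment _ f f' s t st.
- move=> x /itvP xst; apply: df.
    by rewrite (le_trans cs)// xst.
  by rewrite (le_trans _ td)// xst.
- apply: derivable_within_continuous => x /itvP xst.
  apply: ex_derive; apply: df.
    by rewrite (le_trans cs)// xst.
  by rewrite (le_trans _ td)// xst.
- rewrite normrM ler_wpM2r// fM//.
    by rewrite (le_trans cs)// xst.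
  by rewrite (le_trans _ td)// xst.
Qed.

(** By the mean value theorem h is Lipschitz on the range of f. The bound on h' is required only
    there because the exponential, for which the lemma is meant, is not globally Lipschitz. *)
Lemma acd_comp c d f f' h h' M : acd c d f f' ->
  (forall y : R, is_derive y 1 h (h' y)) ->
  (forall x, c <= x -> x <= d -> forall y, `|y| <= `|f x| -> `|h' y| <= M) ->
  acd c d (h \o f) (fun x => h' (f x) * f' x).
Proof.
move=> [acf df] dh hM; split; last first.
  apply: ae_imply df => x H xcd; exact: (is_derive1_comp (dh _) (H xcd)).
have [cd|dc] := ltP d c.
  move=> e e0; exists 1 => // -[|n] s t st _ _; first by rewrite big_ord0.
  have [cs st' td] := st ord0.
  by move: cd; rewrite ltNge (le_trans cs)// (le_trans st').
have M0 : 0 <= M by apply: le_trans (hM c _ _ (f c) _).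
apply: (ac_dom1 M0 _ acf) => s t cs st td /=.
have key x y : c <= x -> x <= d -> c <= y -> y <= d -> f x <= f y ->
    `|h (f y) - h (f x)| <= M * `|f y - f x|.
  move=> cx xd cy yd fxy.
  have [|z /itvP zst ->] := @MVT_segment _ h h' _ _ fxy (fun z _ => dh z).
    by apply: derivable_within_continuous => z _; exact: ex_derive.
  rewrite normrM ler_wpM2r//.
  have [z0|z0] := leP 0 z.
    apply: (hM y) => //; rewrite ger0_norm//.
    by rewrite (le_trans _ (ler_norm _))// zst.
  apply: (hM x) => //; rewrite ltr0_norm// ler_normr; apply/orP; right.
  by rewrite lerN2 zst.
have [fst|fts] := leP (f s) (f t); first by apply: key => //; lra.
by rewrite distrC [X in _ * X]distrC; apply: key; lra.
Qed.

Lemma acd_expR c d f f' : acd c d f f' ->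
  acd c d (fun x => expR (f x)) (fun x => expR (f x) * f' x).
Proof.
move=> fd; have [M M0 fM] := ac_bounded fd.1.
apply: (@acd_comp _ _ _ _ expR expR (expR M) fd) => x cx xd y yx.
rewrite ger0_norm ?expR_ge0// ler_expR.
by rewrite (le_trans (ler_norm _))// (le_trans yx)// fM.
Qed.

Lemma acd_ae_nincr c d f f' : c <= d -> acd c d f f' ->
  {ae mu, forall x, c < x < d -> f' x <= 0} -> f d <= f c.
Proof.
move=> cd [acf df] f'0; apply: ac_nincr => //.
by apply: ae_imply2 df f'0 => x H1 H2 xcd; exists (f' x); [exact: H1|exact: H2].
Qed.

Lemma acd_nincr c d f f' : c <= d -> acd c d f f' ->
  (forall x, c < x < d -> f' x <= 0) -> f d <= f c.
Proof. by move=> cd fd f0; apply: acd_ae_nincr fd _ => //; exact: aeW. Qed.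

Lemma acd_ndecr c d f f' : c <= d -> acd c d f f' ->
  (forall x, c < x < d -> 0 <= f' x) -> f c <= f d.
Proof.
move=> cd fd f0; rewrite -lerN2; apply: (acd_nincr cd (acdN fd)) => x xcd.
by rewrite lerNl oppr0 f0.
Qed.

End ac_derivatives.

(** * Primitives of integrable functions *)

Section primitives.
Context {R : realType}.
Local Notation mu := (@lebesgue_measure R).
Implicit Types (f g h q : R -> R) (a b c d x : R).

Lemma Rintegral_restrict_itv (i : interval R) g c d :
  `]c, d[ `<=` [set` i] ->
  \int[mu]_(y in `]c, d[) (g \_ [set` i]) y = \int[mu]_(y in `]c, d[) g y.
Proof.
move=> sub; apply: eq_Rintegral => y; rewrite inE => ycd.
by rewrite patchE mem_set//; exact: sub.
Qed.

(** Lebesgue differentiation supplies the derivative almost everywhere; absolute continuity of the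
    integral, applied to the union of the given intervals, supplies the rest. *)
Lemma primitive_acd c d g : mu.-integrable `]c, d[ (EFin \o g) ->
  exists2 G : R -> R, acd c d G g &
    forall s t, c <= s -> s <= t -> t <= d ->
      G t - G s = \int[mu]_(y in `]s, t[) g y.
Proof.
(* Extending by 0 lets the primitive start at minus infinity. *)
move=> ig; pose gD := g \_ `]c, d[.
have igD : mu.-integrable setT (EFin \o gD).
  by have := ig; rewrite integrable_mkcond//= (restrict_EFin g).
have igDS (A : set R) : measurable A -> mu.-integrable A (EFin \o gD).
  by move=> mA; apply: integrableS igD.
pose G t := \int[mu]_(y in `]-oo, t]) gD y.
have GE s t : s <= t -> G t - G s = \int[mu]_(y in `]s, t[) gD y.
  move=> st; rewrite /G Rintegral_itvB//; last exact: igDS.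
  by rewrite Rintegral_itv_bndo_bndc//; exact: igDS.
have GE2 s t : c <= s -> s <= t -> t <= d ->
    G t - G s = \int[mu]_(y in `]s, t[) g y.
  move=> cs st td; rewrite GE// Rintegral_restrict_itv//.
  move=> y /=; rewrite !in_itv/= => /andP[sy yt].
  by rewrite (le_lt_trans cs)//= (lt_le_trans yt).
idtac.
exists G => //; split; last first.
  have := FTC1Ny (fun y => igDS _ (measurable_itv _))
    (integrable_locally_restrict (measurable_itv _) ig).
  apply: ae_imply => x [dG GgD] xcd.
  apply: DeriveDef => //; rewrite -derive1E GgD /gD patchE.
  by case: ifPn => //; rewrite notin_setE/= in_itv/= xcd.
move=> e e0; have [eta [eta0 H]] := integral_normr_continuous igD e0.
exists eta => // n s t st dst lst.
pose F (i : 'I_n) := `]s i, t i[%classic.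
have tF : trivIset [set: 'I_n] F.
  apply/trivIsetP => i j _ _ ij; apply/eqP/negPn/negP => /set0P[y []].
  rewrite /F /= !in_itv/= => /andP[y1 y2] /andP[y3 y4].
  by have [] := dst i j ij; lra.
have mF i : measurable (F i) by exact: measurable_itv.
have mD : measurable (\big[setU/set0]_(i < n) F i).
  exact: bigsetU_measurable.
apply: (@le_lt_trans _ _ (\int[mu]_(x in \big[setU/set0]_(i < n) F i) `|gD x|)).
  have -> : \int[mu]_(x in \big[setU/set0]_(i < n) F i) `|gD x| =
      \sum_(i < n) \int[mu]_(x in F i) `|gD x|.
    rewrite /Rintegral sum_fine => [|i _]; last first.
      have /integrable_abse/= := igDS _ (mF i).
      by move=> iF; have := @integrable_fin_num _ _ R mu (F i) (mF i) _ iF.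
    congr (fine _); rewrite ge0_integral_bigsetU//=.
    - by rewrite /index_enum -enumT enum_uniq.
    - exact: sub_trivIset tF.
    - apply: measurable_funTS => /=.
      by case/integrableP: (integrable_abse igD).
  apply: ler_sum => i _; have [_ sti _] := st i.
  rewrite GE//; apply: le_normr_Rintegral => //; exact: igDS.
apply: H => //.
rewrite measure_bigsetU_ord//.
rewrite (_ : \sum_(i < n) _ = (\sum_(i < n) (t i - s i))%:E) ?lte_fin//.
rewrite -sumEFin; apply: eq_bigr => i _; have [_ sti _] := st i.
rewrite [LHS](@lebesgue_measure_itv R `](s i), (t i)[)/= lte_fin EFinB.
by case: ltgtP sti => // -> _; rewrite subee.
Qed.

Lemma ac_integrable c d f : ac c d f -> mu.-integrable `[c, d] (EFin \o f).
Proof.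
move=> acf; apply: continuous_compact_integrable; first exact: segment_compact.
exact: ac_continuous.
Qed.

Lemma ac_integrable_oo c d f : ac c d f -> mu.-integrable `]c, d[ (EFin \o f).
Proof.
move=> /ac_integrable; apply: integrableS => //.
by apply: subset_itvScc; rewrite bnd_simp.
Qed.

Lemma integrable_ac_mul c d q f : mu.-integrable `]c, d[ (EFin \o q) ->
  ac c d f -> mu.-integrable `]c, d[ (EFin \o (fun x => q x * f x)).
Proof.
move=> iq acf.
apply: (@eq_integrable _ _ _ mu _ _ ((EFin \o q) \* (EFin \o f))%E) => //.
apply: integrableMl => //.
  by apply/measurable_EFinP; case/integrableP: (ac_integrable_oo acf).
have [M M0 fM] := ac_bounded acf.
exists M; split; first exact: num_real.
move=> y My x /=; rewrite in_itv/= => /andP[cx xd].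
by rewrite (le_trans _ (ltW My))// fM// ltW.
Qed.

Lemma primitive_ac c d f : ac c d f -> exists2 F : R -> R, acd c d F f &
    forall s t, c <= s -> s <= t -> t <= d ->
      F t - F s = \int[mu]_(y in `]s, t[) f y.
Proof. by move=> acf; apply: primitive_acd; exact: ac_integrable_oo. Qed.

End primitives.

(** * Complex-valued functions *)

Section complex_derivatives.
Context {R : realType}.
Local Notation mu := (@lebesgue_measure R).
Local Notation Re := complex.Re.
Local Notation Im := complex.Im.
Implicit Types (f g u p : R -> R[i]) (c d x : R).

Lemma ReM (x y : R[i]) : Re (x * y) = Re x * Re y - Im x * Im y.
Proof. by case: x; case: y. Qed.

Lemma ImM (x y : R[i]) : Im (x * y) = Re x * Im y + Im x * Re y.
Proof. by case: x; case: y. Qed.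

Lemma ReD (x y : R[i]) : Re (x + y) = Re x + Re y.
Proof. by case: x; case: y. Qed.

Lemma ImD (x y : R[i]) : Im (x + y) = Im x + Im y.
Proof. by case: x; case: y. Qed.

Lemma ReN (x : R[i]) : Re (- x) = - Re x.
Proof. by case: x. Qed.

Lemma ImN (x : R[i]) : Im (- x) = - Im x.
Proof. by case: x. Qed.

Lemma Re_conjc (x : R[i]) : Re (conjc x) = Re x.
Proof. by case: x. Qed.

Lemma Im_conjc (x : R[i]) : Im (conjc x) = - Im x.
Proof. by case: x. Qed.

Definition ReImE := (ReM, ImM, ReD, ImD, ReN, ImN, Re_conjc, Im_conjc).

Lemma complexE (x y : R[i]) : Re x = Re y -> Im x = Im y -> x = y.
Proof. by case: x => a b; case: y => a' b' /= -> ->. Qed.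

(** The squared modulus is polynomial in the components, so that [ring] and [lra] apply and its
    derivative involves no square root. *)
Definition nsq (z : R[i]) : R := Re z ^+ 2 + Im z ^+ 2.

Lemma nsq_ge0 z : 0 <= nsq z.
Proof. by rewrite addr_ge0// sqr_ge0. Qed.

Lemma normcE z : normc z = Num.sqrt (nsq z).
Proof. by case: z. Qed.

Lemma sqr_normc z : normc z ^+ 2 = nsq z.
Proof. by rewrite normcE sqr_sqrtr// nsq_ge0. Qed.

Lemma nsq_eq0 z : (nsq z == 0) = (z == 0).
Proof.
rewrite paddr_eq0 ?sqr_ge0// !sqrf_eq0.
by case: z => a b; rewrite eq_complex.
Qed.

Lemma nsq_gt0 z : (0 < nsq z) = (z != 0).
Proof. by rewrite lt_neqAle nsq_ge0 andbT eq_sym nsq_eq0. Qed.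

Lemma nsqM y z : nsq (y * z) = nsq y * nsq z.
Proof. by case: y => a b; case: z => a' b'; rewrite /nsq /=; ring. Qed.

Lemma nsq_conjc z : nsq (conjc z) = nsq z.
Proof. by rewrite /nsq !ReImE sqrrN. Qed.

Lemma conjcM (x y : R[i]) : conjc (x * y) = conjc x * conjc y.
Proof. exact: rmorphM. Qed.

Lemma conjcB (x y : R[i]) : conjc (x - y) = conjc x - conjc y.
Proof. exact: rmorphB. Qed.

Lemma conjcR (x : R) : conjc x%:C = x%:C.
Proof. by apply: complexE; rewrite !ReImE /= ?oppr0. Qed.

Lemma mulCconj (z : R[i]) : z * conjc z = (nsq z)%:C.
Proof. by apply: complexE; rewrite !ReImE /nsq/=; ring. Qed.

Lemma invCE (z : R[i]) : z != 0 -> z^-1 = conjc z * ((nsq z)^-1)%:C.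
Proof.
move=> z0; apply: (mulfI z0); rewrite divff// mulrA mulCconj.
by apply: complexE; rewrite !ReImE /= ?mulr0 ?mul0r ?subr0 ?addr0// divff// nsq_eq0.
Qed.

Lemma nsqV (z : R[i]) : z != 0 -> nsq z^-1 = (nsq z)^-1.
Proof.
move=> z0; have : nsq z * nsq z^-1 = 1.
  by rewrite -nsqM divff// /nsq /= expr1n expr0n addr0.
have nz0 : nsq z != 0 by rewrite nsq_eq0.
by move=> H; apply: (mulfI nz0); rewrite H divff.
Qed.

Definition acdC c d f f' : Prop :=
  acd c d (fun x => Re (f x)) (fun x => Re (f' x)) /\
  acd c d (fun x => Im (f x)) (fun x => Im (f' x)).

Lemma acdC_sub c d c' d' f f' : c <= c' -> d' <= d -> acdC c d f f' ->
  acdC c' d' f f'.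
Proof. by move=> cc dd [? ?]; split; apply: acd_sub cc dd _. Qed.

Lemma acdC_eq c d f f' g : acdC c d f f' ->
  (forall x, c < x < d -> f' x = g x) -> acdC c d f g.
Proof. by move=> [H1 H2] fg; split; [apply: (acd_eq H1)|apply: (acd_eq H2)] =>
  x /fg ->. Qed.

Lemma acdC_cst c d k : acdC c d (fun=> k) (fun=> 0).
Proof. by split; exact: acd_cst. Qed.

Lemma acdCD c d f f' g g' : acdC c d f f' -> acdC c d g g' ->
  acdC c d (fun x => f x + g x) (fun x => f' x + g' x).
Proof.
move=> [fr fi] [gr gi]; split.
- rewrite (_ : (fun x => _) = (fun x => Re (f x) + Re (g x))); last first.
    by apply/funext => x; rewrite ReD.
  by apply: (acd_eq (acdD fr gr)) => x _; rewrite ReD.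
- rewrite (_ : (fun x => _) = (fun x => Im (f x) + Im (g x))); last first.
    by apply/funext => x; rewrite ImD.
  by apply: (acd_eq (acdD fi gi)) => x _; rewrite ImD.
Qed.

Lemma acdCM c d f f' g g' : acdC c d f f' -> acdC c d g g' ->
  acdC c d (fun x => f x * g x) (fun x => f' x * g x + f x * g' x).
Proof.
move=> [fr fi] [gr gi]; split.
- rewrite (_ : (fun x => _) = (fun x => Re (f x) * Re (g x) - Im (f x) * Im (g
  x))); last first.
    by apply/funext => x; rewrite ReM.
  by apply: (acd_eq (acdB (acdM fr gr) (acdM fi gi))) => x _; rewrite !ReImE; ring.
- rewrite (_ : (fun x => _) = (fun x => Re (f x) * Im (g x) + Im (f x) * Re (g
  x))); last first.
    by apply/funext => x; rewrite ImM.
  by apply: (acd_eq (acdD (acdM fr gi) (acdM fi gr))) => x _; rewrite !ReImE; ring.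
Qed.

Lemma acdCZ c d k f f' : acdC c d f f' ->
  acdC c d (fun x => k * f x) (fun x => k * f' x).
Proof.
move=> /(acdCM (acdC_cst c d k)) /acdC_eq; apply => x _.
by rewrite mul0r add0r.
Qed.

Lemma acdCN c d f f' : acdC c d f f' ->
  acdC c d (fun x => - f x) (fun x => - f' x).
Proof.
move=> /(acdCZ (-1)) fd; rewrite (_ : (fun x => - f x) = (fun x => -1 * f x)).
  by apply: (acdC_eq fd) => x _; rewrite mulN1r.
by apply/funext => x; rewrite mulN1r.
Qed.

Lemma acdCB c d f f' g g' : acdC c d f f' -> acdC c d g g' ->
  acdC c d (fun x => f x - g x) (fun x => f' x - g' x).
Proof. by move=> fd /acdCN; exact: acdCD. Qed.

Lemma acdC_conj c d f f' : acdC c d f f' ->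
  acdC c d (fun x => conjc (f x)) (fun x => conjc (f' x)).
Proof.
move=> [fr fi]; split.
- rewrite (_ : (fun x => _) = (fun x => Re (f x))); last first.
    by apply/funext => x; rewrite Re_conjc.
  by apply: (acd_eq fr) => x _; rewrite Re_conjc.
- rewrite (_ : (fun x => _) = (fun x => - Im (f x))); last first.
    by apply/funext => x; rewrite Im_conjc.
  by apply: (acd_eq (acdN fi)) => x _; rewrite Im_conjc.
Qed.

Lemma acdC_real c d (f f' : R -> R) : acd c d f f' ->
  acdC c d (fun x => (f x)%:C) (fun x => (f' x)%:C).
Proof. by move=> fd; split => //=; exact: acd_cst. Qed.

Lemma acd_nsq c d f f' : acdC c d f f' ->
  acd c d (fun x => nsq (f x))
          (fun x => 2 * (Re (f x) * Re (f' x) + Im (f x) * Im (f' x))).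
Proof.
move=> [fr fi]; rewrite /nsq.
rewrite (_ : (fun x => _) = (fun x => Re (f x) * Re (f x) + Im (f x) * Im (f x))).
  by apply: (acd_eq (acdD (acdM fr fr) (acdM fi fi))) => x _; ring.
by apply/funext => x; rewrite !expr2.
Qed.

(** Writing 1 / f = conj f / |f|^2 leaves only the reciprocal of a positive real function. The
    identity also holds at zeros of f, where both sides are 0 by convention. *)
Lemma acdCV c d f f' : (forall x, c <= x -> x <= d -> f x != 0) ->
  acdC c d f f' -> acdC c d (fun x => (f x)^-1) (fun x => - f' x / f x ^+ 2).
Proof.
move=> f0 fd.
have nf x : c <= x -> x <= d -> 0 < nsq (f x) by move=> cx xd; rewrite nsq_gt0 f0.
rewrite (_ : (fun x => (f x)^-1) = (fun x => conjc (f x) * ((nsq (f x))^-1)%:C)).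
  apply: (acdC_eq (acdCM (acdC_conj fd) (acdC_real (acdV nf (acd_nsq fd))))).
  move=> x /andP[cx xd].
  have fx0 : f x != 0 by apply: f0; exact: ltW.
  have : nsq (f x) != 0 by rewrite nsq_eq0.
  rewrite -[_ ^- 2 in RHS]exprVn invCE// expr2 /nsq.
  case: (f x) => a b; case: (f' x) => a' b' /= N0.
  by apply: complexE; rewrite /=; field.
apply/funext => x; have [->|/invCE//] := eqVneq (f x) 0.
by rewrite invr0 conjc0 mul0r.
Qed.

End complex_derivatives.

(** * Solutions and their flux *)

Section solutions.
Context {R : realType}.
Local Notation mu := (@lebesgue_measure R).
Local Notation Re := complex.Re.
Local Notation Im := complex.Im.
Implicit Types (q : R -> R) (z : R[i]) (f g u p v w : R -> R[i]) (b : \bar R)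
  (c d x : R).

(* The second function stands for the derivative of the first. *)
Definition local_solution q b z u p : Prop :=
  forall c d, in_itv0 b c -> in_itv0 b d ->
    acdC c d u p /\ acdC c d p (fun x => ((q x)%:C - z) * u x).

Lemma normr_Re_le (z : R[i]) : `|Re z| <= normc z.
Proof.
rewrite normcE -sqrtr_sqr ler_wsqrtr// /nsq lerDl sqr_ge0//.
Qed.

Lemma normr_Im_le (z : R[i]) : `|Im z| <= normc z.
Proof.
rewrite normcE -sqrtr_sqr ler_wsqrtr// /nsq lerDr sqr_ge0//.
Qed.

Lemma abs_continuousC_ac c d f : abs_continuousC c d f ->
  ac c d (fun x => Re (f x)) /\ ac c d (fun x => Im (f x)).
Proof.
move=> acf; split=> e /acf[eta eta0 H]; exists eta => // n s t st dst lst;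
  (apply: le_lt_trans (H n s t st dst lst); apply: ler_sum => i _).
- by rewrite (le_trans _ (normr_Re_le _))// !ReImE.
- by rewrite (le_trans _ (normr_Im_le _))// !ReImE.
Qed.

Lemma in_itv0W b x y : in_itv0 b x -> 0 < y -> y <= x -> in_itv0 b y.
Proof.
move=> [_ xb] y0 yx; split => //; apply: le_lt_trans xb.
by rewrite lee_fin.
Qed.

(** On [c, d] the derivative of u is absolutely continuous, hence bounded, which makes u Lipschitz;
    the equation identifies the derivative of u' almost everywhere. *)
Lemma solves_local q b z u : solves q b z u -> local_solution q b z u (deriveC u).
Proof.
move=> [du acu aeu] c d cb db.
have [acr aci] := abs_continuousC_ac (acu c d cb db).
have [c0 _] := cb.
have cdb x : c <= x -> x <= d -> in_itv0 b x.
  by move=> cx xd; apply: in_itv0W db _ xd; exact: lt_le_trans cx.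
split; split.
- have [M _ HM] := ac_bounded acr; apply: acd_C1 HM => x cx xd.
  have [dr _] := du x (cdb x cx xd).
  by rewrite /deriveC /= derive1E; exact: derivableP.
- have [M _ HM] := ac_bounded aci; apply: acd_C1 HM => x cx xd.
  have [_ di] := du x (cdb x cx xd).
  by rewrite /deriveC /= derive1E; exact: derivableP.
- split => //; apply: ae_imply aeu => x H /andP[cx xd].
  have [|[dr _] E] := H; first by apply: cdb; exact: ltW.
  rewrite (_ : (_ - z) * u x = deriveC (deriveC u) x).
    by rewrite {2}/deriveC /= derive1E; exact: derivableP.
  by rewrite mulrBl -E opprD opprK addrC subrK.
- split => //; apply: ae_imply aeu => x H /andP[cx xd].
  have [|[_ di] E] := H; first by apply: cdb; exact: ltW.
  rewrite (_ : (_ - z) * u x = deriveC (deriveC u) x).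
    by rewrite {2}/deriveC /= derive1E; exact: derivableP.
  by rewrite mulrBl -E opprD opprK addrC subrK.
Qed.

Definition wronskian u p v w x : R[i] := u x * w x - p x * v x.

(* The imaginary part of [p / u], multiplied by [|u|^2]. *)
Definition flux u p x : R := Im (conjc (u x) * p x).

Section local.
Variables (q : R -> R) (b : \bar R) (z : R[i]) (u p : R -> R[i]).
Hypothesis su : local_solution q b z u p.
Hypothesis iq : forall d, in_itv0 b d -> mu.-integrable `]0, d[ (EFin \o q).

(** As [q] is real, both |u'|^2 and q |u|^2 drop out of the imaginary part of (conj u u')'. *)
Lemma acd_flux c d : in_itv0 b c -> in_itv0 b d ->
  acd c d (flux u p) (fun x => - Im z * nsq (u x)).
Proof.
move=> cb db; have [du dp] := su cb db.
apply: (acd_eq (acdCM (acdC_conj du) dp).2) => x _.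
rewrite !ReImE /= /nsq; ring.
Qed.

Lemma primitive_absq c d : in_itv0 b c -> in_itv0 b d ->
  exists2 G : R -> R, acd c d G (fun x => `|q x|) &
    forall s t, c <= s -> s <= t -> t <= d ->
      G t - G s = \int[mu]_(y in `]s, t[) `|q y|.
Proof.
move=> [c0 _] db; apply: primitive_acd.
have := integrable_abse (iq db); apply: integrableS => //.
move=> y /=; rewrite !in_itv/= => /andP[cy ->].
by rewrite (lt_trans c0).
Qed.

Let E x := nsq (u x) + nsq (p x).

(** From E' = 2 (1 + q - Re z) Re (conj u p) - 2 Im z Im (conj u p), where twice either component of
    conj u p is at most E in absolute value. *)
Let K := 1 + `|Re z| + `|Im z|.

(* Both [E exp(G)] and [E exp(-G)] are monotone when [G' = K + |q|]. *)
Lemma energy_gronwall c d G : in_itv0 b c -> in_itv0 b d -> c <= d ->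
  acd c d G (fun x => `|q x|) ->
  E d <= E c * expR (G d - G c + K * (d - c)) /\
  E c <= E d * expR (G d - G c + K * (d - c)).
Proof.
move=> cb db cd dG; have [du dp] := su cb db.
have dE : acd c d E (fun x => 2 * (Re (u x) * Re (p x) + Im (u x) * Im (p x)) +
   2 * (Re (p x) * ((q x - Re z) * Re (u x) + Im z * Im (u x)) +
        Im (p x) * ((q x - Re z) * Im (u x) - Im z * Re (u x)))).
  apply: (acd_eq (acdD (acd_nsq du) (acd_nsq dp))) => x _.
  by rewrite !ReImE /=; ring.
set E' := (X in acd _ _ E X) in dE.
have E'E x : `|E' x| <= (K + `|q x|) * E x.
  rewrite /E' /E /K /nsq.
  case: (u x) => a1 b1; case: (p x) => a2 b2 /=; case: (z) => zr zi /=.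
  set y := (X in `|X|); set EE := (X in _ <= _ * X).
  have -> : y = (2 * (a1 * a2 + b1 * b2)) * (1 + q x - zr) +
                (2 * (a2 * b1 - b2 * a1)) * zi by rewrite /y; ring.
  have kA : `|2 * (a1 * a2 + b1 * b2)| <= EE.
    rewrite ler_norml /EE; apply/andP; split.
      by have := sqr_ge0 (a1 + a2); have := sqr_ge0 (b1 + b2); lra.
    by have := sqr_ge0 (a1 - a2); have := sqr_ge0 (b1 - b2); lra.
  have kB : `|2 * (a2 * b1 - b2 * a1)| <= EE.
    rewrite ler_norml /EE; apply/andP; split.
      by have := sqr_ge0 (a2 + b1); have := sqr_ge0 (b2 - a1); lra.
    by have := sqr_ge0 (a2 - b1); have := sqr_ge0 (b2 + a1); lra.
  have kT : `|1 + q x - zr| <= 1 + `|q x| + `|zr|.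
    rewrite (le_trans (ler_normB _ _))// lerD2r (le_trans (ler_normD _ _))//.
    by rewrite normr1.
  rewrite (le_trans (ler_normD _ _))// !normrM.
  have := normr_ge0 (2 * (a1 * a2 + b1 * b2)); rewrite normrM.
  have := normr_ge0 (2 * (a2 * b1 - b2 * a1)); rewrite normrM.
  rewrite !normrM in kA kB; move: kA kB kT.
  set x1 := `|2| * _; set x2 := `|2| * `|a2 * _ - _|; set x3 := `|1 + _ - _|.
  have := normr_ge0 zi; set x4 := `|zi|; have : 0 <= x3 by exact: normr_ge0.
  move=> *; have : x1 * x3 <= EE * (1 + `|q x| + `|zr|) by rewrite ler_pM.
  have : x2 * x4 <= EE * x4 by rewrite ler_wpM2r.
  lra.
have dg : acd c d (fun x => G x + K * x) (fun x => `|q x| + K).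
  apply: (acd_eq (acdD dG (acdZ K (acd_id c d)))) => x _.
  by rewrite mulr1.
split.
- have := acd_nincr cd (acdM dE (acd_expR (acdN dg))).
  rewrite -(ler_pM2r (expR_gt0 (G d + K * d))) -!mulrA -!expRD addNr expR0 mulr1.
  rewrite (_ : - _ + _ = G d - G c + K * (d - c)); last by ring.
  apply => x _; set e := expR _.
  rewrite (_ : _ + _ = e * (E' x - (K + `|q x|) * E x)); last by ring.
  rewrite pmulr_rle0 ?expR_gt0// subr_le0.
  by rewrite (le_trans (ler_norm _) (E'E x)).
- have := acd_ndecr cd (acdM dE (acd_expR dg)).
  rewrite -(ler_pM2r (expR_gt0 (- (G c + K * c)))) -!mulrA -!expRD subrr expR0
    mulr1.
  rewrite (_ : _ + _ = G d - G c + K * (d - c)); last by ring.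
  apply => x _; set e := expR _.
  rewrite (_ : _ + _ = e * (E' x + (K + `|q x|) * E x)); last by ring.
  rewrite pmulr_rge0 ?expR_gt0// -lerBlDr sub0r lerNl.
  by rewrite (le_trans _ (E'E x))// -normrN ler_norm.
Qed.

End local.
End solutions.

(** * Uniqueness for the initial value problem and strict positivity of the flux *)

Section positivity.
Context {R : realType}.
Local Notation mu := (@lebesgue_measure R).
Local Notation Re := complex.Re.
Local Notation Im := complex.Im.
Implicit Types (q : R -> R) (z : R[i]) (u p v w : R -> R[i]) (b : \bar R) (c d
  x : R).

Lemma ac_dist_lt c d (f : R -> R) e : ac c d f -> 0 < e ->
  exists2 eta, 0 < eta & forall s t, c <= s -> s <= t -> t <= d ->
    t - s < eta -> `|f t - f s| < e.
Proof.
move=> acf /acf[eta eta0 H]; exists eta => // s t cs st td ste.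
have := H 1%N (fun=> s) (fun=> t); rewrite !big_ord1; apply => //.
by move=> i j; rewrite !ord1 eqxx.
Qed.

(** A continuous derivative is attained at every interior point: near x, subtracting from f the
    linear function of slope f' x - e or f' x + e leaves a nondecreasing or a nonincreasing
    function. *)
Lemma acd_is_derive c d (f f' : R -> R) x : acd c d f f' -> ac c d f' ->
  c < x < d -> is_derive x 1 f (f' x).
Proof.
move=> df acf' /andP[cx xd].
suff H : h^-1 *: (f (h *: (1:R) + x) - f x) @[h --> 0^'] --> f' x.
  by apply: DeriveDef; [apply/cvg_ex; exists (f' x)|apply: cvg_lim].
apply/cvgrPdist_le => e e0.
have [eta eta0 feta] := ac_dist_lt acf' e0.
have key s t : c <= s -> t <= d -> s <= x -> x <= t -> s <= t -> t - s < eta ->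
    `|f t - f s - f' x * (t - s)| <= e * (t - s).
  move=> cs td sx xt st ste.
  have f'x y : s < y < t -> `|f' y - f' x| < e.
    move=> /andP[sy yt]; have [yx|xy] := leP y x.
      by rewrite distrC; apply: feta; lra.
    by apply: feta; lra.
  rewrite ler_norml; apply/andP; split.
  - have dg := acdB (acd_sub cs td df) (acdZ (f' x - e) (acd_id s t)).
    have := acd_ndecr st dg; set P := (forall x, _);
      suff : P by move=> + H => /H /=; lra.
    by move=> y /f'x; rewrite ltr_norml => /andP[]; lra.
  - have dg := acdB (acd_sub cs td df) (acdZ (f' x + e) (acd_id s t)).
    have := acd_nincr st dg; set P := (forall x, _);
      suff : P by move=> + H => /H /=; lra.
    by move=> y /f'x; rewrite ltr_norml => /andP[]; lra.
have r0 : 0 < Num.min eta (Num.min (x - c) (d - x)).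
  by rewrite !lt_min eta0 !subr_gt0 cx.
near=> h.
have h0 : h != 0 by near: h; exact: nbhs_dnbhs_neq.
have : `|h| < Num.min eta (Num.min (x - c) (d - x)).
  by near: h; apply: dnbhs0_lt.
rewrite !lt_min => /and3P[h1 h2 h3].
rewrite /GRing.scale/= mulr1.
have -> : f' x - h^-1 * (f (h + x) - f x) = - (h^-1 * (f (h + x) - f x - f' x * h)).
  by field.
rewrite normrN normrM normfV ler_pdivrMl ?normr_gt0// [leRHS]mulrC.
have := ler_norm h; have := ler_norm (- h); rewrite normrN => hn hp.
have [hge0|hlt0] := leP 0 h.
  have := key x (h + x); rewrite addrK (ger0_norm hge0) => H; apply: H; lra.
have := key (h + x) x; rewrite (ltr0_norm hlt0) opprD addrCA subrr addr0.
rewrite -normrN.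
have -> : - (f x - f (h + x) - f' x * - h) = f (h + x) - f x - f' x * h by ring.
by move=> H; apply: H; lra.
Unshelve. all: by end_near. Qed.

Lemma is_derive_loc_cst c d (f : R -> R) x k l : c < x < d ->
  (forall t, c < t < d -> f t = k) -> is_derive x 1 f l -> l = 0.
Proof.
move=> /andP[cx xd] fk fl.
have H : is_derive x 1 (cst k : R -> R) l.
  apply: near_eq_is_derive fl.
  near=> t; apply: fk; apply/andP; split; near: t.
    exact: lt_nbhsr.
  exact: lt_nbhsl.
by rewrite -(@derive_val _ _ _ _ _ _ _ H) derive_cst.
Unshelve. all: by end_near. Qed.

Section local.
Variables (q : R -> R) (b : \bar R) (z : R[i]) (u p : R -> R[i]).
Hypothesis su : local_solution q b z u p.
Hypothesis iq : forall d, in_itv0 b d -> mu.-integrable `]0, d[ (EFin \o q).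

(** The energy |u|^2 + |p|^2 vanishes at [x0], and the two halves of [energy_gronwall] carry this to
    the right and to the left. *)
Lemma solution_eq0 x0 : in_itv0 b x0 -> u x0 = 0 -> p x0 = 0 ->
  forall x, in_itv0 b x -> u x = 0 /\ p x = 0.
Proof.
move=> x0b u0 p0 x xb.
suff : nsq (u x) + nsq (p x) <= 0.
  rewrite le_eqVlt ltNge addr_ge0 ?nsq_ge0//= orbF.
  by rewrite paddr_eq0 ?nsq_ge0// !nsq_eq0 => /andP[/eqP ? /eqP].
have E0 : nsq (u x0) + nsq (p x0) = 0.
  by rewrite u0 p0 /nsq/= expr0n /= !addr0.
have [xx0|x0x] := leP x x0.
  have [G dG _] := primitive_absq iq xb x0b.
  by have [_] := energy_gronwall su xb x0b xx0 dG; rewrite E0 mul0r.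
have [G dG _] := primitive_absq iq x0b xb.
by have [+ _] := energy_gronwall su x0b xb (ltW x0x) dG; rewrite E0 mul0r.
Qed.

Lemma flux_nincr c d : 0 <= Im z -> in_itv0 b c -> in_itv0 b d -> c <= d ->
  flux u p d <= flux u p c.
Proof.
move=> z0 cb db cd; apply: (acd_nincr cd (acd_flux su cb db)) => x _.
by rewrite mulNr oppr_le0 mulr_ge0// nsq_ge0.
Qed.

Lemma in_itv0_right x : in_itv0 b x -> exists2 y, in_itv0 b y & x < y.
Proof.
move=> [x0 xb]; case: b xb => [r| |]//=.
- rewrite lte_fin => xr; exists ((x + r) / 2); rewrite /in_itv0 ?lte_fin; last lra.
  by split; lra.
- by move=> _; exists (x + 1); rewrite /in_itv0 ?ltry ?ltrDl//; split => //; lra.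
Qed.

(** If the flux vanished at y, then, being nonnegative and nonincreasing, it would vanish to the
    right of y. Its derivative - Im z |u|^2 would be 0 there, so u would vanish on an interval,
    hence everywhere. *)
Lemma flux_gt0 : 0 < Im z -> nonzero_on b u ->
  (forall x, in_itv0 b x -> 0 <= flux u p x) ->
  forall x, in_itv0 b x -> 0 < flux u p x.
Proof.
move=> z0 [x1 x1b ux1] flux0 y yb; rewrite lt_neqAle flux0// andbT.
apply/eqP => fy; move: ux1; apply/negP/negPn/eqP.
have [t tb yt] := in_itv0_right yb.
have ytb x : y < x < t -> in_itv0 b x.
  move=> /andP[yx xt]; apply: in_itv0W tb _ _; last exact: ltW.
  by case: yb => y0 _; exact: lt_trans yx.
have fxt x : y < x < t -> flux u p x = 0.
  move=> xyt; apply/eqP; rewrite eq_le flux0 ?andbT ?fy; last exact: ytb.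
  by apply: flux_nincr => //; [exact: ltW|exact: ytb|case/andP: xyt => /ltW].
have [du dp] := su yb tb.
have u0 x : y < x < t -> u x = 0.
  move=> xyt; apply/eqP; rewrite -nsq_eq0.
  have acn := (acdZ (- Im z) (acd_nsq du)).1.
  have := acd_is_derive (acd_flux su yb tb) acn xyt.
  move=> /(is_derive_loc_cst xyt fxt) /eqP; rewrite mulf_eq0 oppr_eq0.
  by rewrite (gt_eqF z0).
have mid : y < (y + t) / 2 < t by apply/andP; split; lra.
suff p0 : p ((y + t) / 2) = 0 by case: (solution_eq0 (ytb _ mid) (u0 _ mid) p0 x1b).
apply: complexE => /=.
- apply: (is_derive_loc_cst mid _ (acd_is_derive du.1 dp.1.1 mid)) => x /u0 ->.
  by [].
- apply: (is_derive_loc_cst mid _ (acd_is_derive du.2 dp.2.1 mid)) => x /u0 ->.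
  by [].
Qed.

End local.
End positivity.

(** * A second solution *)

Section second_solution.
Context {R : realType}.
Local Notation mu := (@lebesgue_measure R).
Local Notation Re := complex.Re.
Local Notation Im := complex.Im.
Implicit Types (q : R -> R) (z : R[i]) (u p v w : R -> R[i]) (c d x : R).

Lemma acd_eqf c d (f g f' : R -> R) :
  (forall x, c <= x -> x <= d -> f x = g x) -> acd c d f f' -> acd c d g f'.
Proof.
move=> fg [acf df]; split.
  move=> e /acf[eta eta0 H]; exists eta => // n s t st dst lst.
  rewrite (eq_bigr (fun i => `|f (t i) - f (s i)|)); first exact: H.
  by move=> i _; have [cs sti td] := st i; rewrite !fg//; lra.
apply: ae_imply df => x H /andP[cx xd].
apply: near_eq_is_derive (H _); last by rewrite cx.
near=> t; apply: fg; apply: ltW; near: t.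
  exact: lt_nbhsr.
exact: lt_nbhsl.
Unshelve. all: by end_near. Qed.

(** A single function must serve on all intervals at once; basing the integral at 1, with the sign
    adjusted to its left, fixes the constant. *)
Lemma global_primitive (g : R -> R) :
  (forall c d, 0 < c -> mu.-integrable `]c, d[ (EFin \o g)) ->
  exists G : R -> R, forall c d, 0 < c -> acd c d G g.
Proof.
move=> ig.
exists (fun t => if 1 <= t then \int[mu]_(y in `]1, t[) g y
                 else - \int[mu]_(y in `]t, 1[) g y) => c d c0.
have c'0 : 0 < Num.min c 1 by rewrite lt_min c0 ltr01.
(* The interval is enlarged to contain 1, so that the local primitive can be normalised at 1. *)
have [G dG GE] := primitive_acd (ig (Num.min c 1) (Num.max d 1) c'0).
have dG' := acdB (acd_sub (_ : _ <= c) (_ : d <= _) dG) (acd_cst c d (G 1)).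
apply: acd_eqf (acd_eq (dG' _ _) _).
- move=> x cx xd; case: leP => x1.
    by rewrite GE// ?ge_min ?le_max ?xd ?lexx ?orbT.
  rewrite -GE ?ge_min ?le_max ?cx ?lexx ?orbT// ?(ltW x1)//.
  by rewrite opprB.
- by rewrite ge_min lexx.
- by rewrite le_max lexx.
- by move=> x _; rewrite subr0.
Qed.

Lemma normc_leD (y : R[i]) : normc y <= `|Re y| + `|Im y|.
Proof.
rewrite normcE -[leRHS]ger0_norm ?addr_ge0// -sqrtr_sqr ler_wsqrtr//.
rewrite /nsq sqrrD !real_normK ?num_real//.
by rewrite lerD2r lerDl mulrn_wge0// mulr_ge0.
Qed.

Lemma ac_abs_continuousC c d (f : R -> R[i]) :
  ac c d (fun x => Re (f x)) -> ac c d (fun x => Im (f x)) -> abs_continuousC c d f.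
Proof.
move=> fr fi e e0; have e20 : 0 < e / 2 by rewrite divr_gt0.
have [e1 e10 H1] := fr _ e20; have [e2 e20' H2] := fi _ e20.
exists (Num.min e1 e2); first by rewrite lt_min e10.
move=> n s t st dst; rewrite lt_min => /andP[/(H1 _ _ _ st dst) {}H1].
move=> /(H2 _ _ _ st dst) {}H2; rewrite [e]splitr.
apply: le_lt_trans (ltrD H1 H2); rewrite -big_split; apply: ler_sum => i _.
by rewrite (le_trans (normc_leD _))// !ReImE.
Qed.

Lemma itv0y x : 0 < x -> in_itv0 +oo%E x.
Proof. by move=> x0; split => //; exact: ltry. Qed.

(** The limit point and limit circle hypotheses speak of [solves], so the solutions constructed
    below must be brought back to that form. *)
Lemma local_solution_solves q z v w : local_solution q +oo%E z v w ->
  solves q +oo%E z v /\ forall x, 0 < x -> deriveC v x = w x.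
Proof.
move=> sv.
have dv x : 0 < x -> is_derive x 1 (fun t => Re (v t)) (Re (w x)) /\
                     is_derive x 1 (fun t => Im (v t)) (Im (w x)).
  move=> x0; have x20 : 0 < x / 2 by rewrite divr_gt0.
  have x10 : 0 < x + 1 by rewrite addr_gt0.
  have [[dr di] [[wronskian _] [wi _]]] := sv _ _ (itv0y x20) (itv0y x10).
  have xx : x / 2 < x < x + 1 by apply/andP; split; lra.
  by split; [exact: acd_is_derive dr wronskian xx|exact: acd_is_derive di wi xx].
have dvw x : 0 < x -> deriveC v x = w x.
  by move=> /dv[dr di]; apply: complexE; rewrite /= derive1E derive_val.
split => //.
have dw c d : in_itv0 +oo c -> in_itv0 +oo d ->
    acdC c d (deriveC v) (fun x => ((q x)%:C - z) * v x).
  move=> cb db; have [_ [wronskian wi]] := sv c d cb db; have [c0 _] := cb.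
  by split; [apply: acd_eqf wronskian|apply: acd_eqf wi] => x cx _;
    rewrite dvw// (lt_le_trans c0).
split.
- by move=> x [/dv[dr di] _]; split; exact: ex_derive.
- by move=> c d cb db; have [[wronskian _] [wi _]] := dw c d cb db;
  exact: ac_abs_continuousC.
(* The half-line is exhausted by countably many bounded intervals, each with its own null set; x is
   caught once n + 1 exceeds x + 1 / x. *)
- have H (n : nat) : {ae mu, forall x, n.+1%:R^-1 < x < n.+1%:R ->
      derivableC (deriveC v) x /\
      - deriveC (deriveC v) x + (q x)%:C * v x = z * v x}.
    have n0 : 0 < n.+1%:R^-1 :> R by rewrite invr_gt0.
    have [[_ wronskian] [_ wi]] := dw _ _ (itv0y n0) (itv0y (ltr0Sn R n)).
    apply: ae_imply2 wronskian wi => x Hr Hi xn.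
    have {}Hr := Hr xn; have {}Hi := Hi xn.
    split; first by split; exact: ex_derive.
    have -> : deriveC (deriveC v) x = ((q x)%:C - z) * v x.
      by apply: complexE; rewrite /deriveC [LHS]/= derive1E derive_val.
    by ring.
  apply: ae_imply (ae_foralln H) => x Hx [x0 _].
  pose n := Num.bound (x + x^-1).
  have xV : 0 < x^-1 by rewrite invr_gt0.
  have xn : x + x^-1 < n.+1%:R.
    rewrite (lt_le_trans (archi_boundP _)) ?addr_ge0 ?(ltW x0) ?(ltW xV)//.
    by rewrite ler_nat.
  apply: (Hx n); apply/andP; split; last by lra.
  by rewrite invf_plt ?posrE// (lt_trans _ xn)// ltrDr.
Qed.

Variables (q : R -> R) (z : R[i]) (u p : R -> R[i]).
Hypothesis su : local_solution q +oo%E z u p.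
Hypothesis iq : forall d, in_itv0 +oo%E d -> mu.-integrable `]0, d[ (EFin \o q).
Hypothesis up0 : forall x, 0 < x -> u x != 0 \/ p x != 0.

(* Rofe-Beketov's formula: [v = - conj u' / E + g u] and
   [v' = conj u / E + g u'] with [E = |u|^2 + |u'|^2], which unlike
   [u * \int u^-2] is not singular at a zero of [u]. *)
Lemma second_solution : exists v w, local_solution q +oo%E z v w /\
  forall x, 0 < x -> wronskian u p v w x = 1.
Proof.
pose E x := u x * conjc (u x) + p x * conjc (p x).
have E0 x : 0 < x -> E x != 0.
  move=> x0; rewrite /E !mulCconj -rmorphD fmorph_eq0.
  by rewrite paddr_eq0 ?nsq_ge0// !nsq_eq0 negb_and; apply/orP/up0.
pose E' x := p x * conjc (u x) + u x * conjc (p x) +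
           (((q x)%:C - z) * u x * conjc (p x) +
            p x * (((q x)%:C - conjc z) * conjc (u x))).
have dE c d : 0 < c -> 0 < d -> acdC c d E E'.
  move=> c0 d0; have [du dp] := su (itv0y c0) (itv0y d0).
  apply: (acdC_eq (acdCD (acdCM du (acdC_conj du)) (acdCM dp (acdC_conj dp)))).
  by move=> x _; rewrite /E' !conjcM conjcB conjcR.
have dV c d : 0 < c -> 0 < d -> acdC c d (fun x => (E x)^-1) (fun x => - E' x /
  E x ^+ 2).
  move=> c0 d0; apply: acdCV (dE c d c0 d0) => x cx _.
  by apply: E0; exact: lt_le_trans cx.
(* The requirement v' = w determines g'. Splitting off the part proportional to [q] gives g' = q A +
   B with A and B locally absolutely continuous, so that g' is locally integrable. *)
pose A x := (conjc (u x) * conjc (u x) - conjc (p x) * conjc (p x)) * ((E x)^-1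
  * (E x)^-1).
pose B x := ((1 - conjc z) * (conjc (u x) * conjc (u x)) -
             (1 - z) * (conjc (p x) * conjc (p x))) * ((E x)^-1 * (E x)^-1).
have acAB c d : 0 < c -> 0 < d -> [/\ ac c d (fun x => Re (A x)), ac c d (fun x
  => Im (A x)),
    ac c d (fun x => Re (B x)) & ac c d (fun x => Im (B x))].
  move=> c0 d0; have [du dp] := su (itv0y c0) (itv0y d0).
  have dVV := acdCM (dV c d c0 d0) (dV c d c0 d0).
  have duu := acdCM (acdC_conj du) (acdC_conj du).
  have dpp := acdCM (acdC_conj dp) (acdC_conj dp).
  have [[A1 _] [A2 _]] := acdCM (acdCB duu dpp) dVV.
  have [[B1 _] [B2 _]] := acdCM (acdCB (acdCZ (1 - conjc z) duu) (acdCZ (1 - z)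
    dpp)) dVV.
  by split.
pose g' x := (q x)%:C * A x + B x.
have iqAB (a b : R -> R) c d : (0 < c -> 0 < d -> ac c d a /\ ac c d b) -> 0 < c ->
    mu.-integrable `]c, d[ (EFin \o (fun x => q x * a x + b x)).
  move=> ab c0; have [d0|d0] := leP d 0.
    rewrite set_itv_ge ?bnd_simp -?leNgt ?(le_trans d0 (ltW c0))//.
    exact: integrable_set0.
  have [aca acb] := ab c0 d0.
  have iqcd : mu.-integrable `]c, d[ (EFin \o q).
    have := iq (itv0y d0); apply: integrableS => //.
    by apply: subset_itvr; rewrite bnd_simp ltW.
  exact: (@integrableD _ _ R mu `]c, d[ (measurable_itv _) _ _
    (integrable_ac_mul iqcd aca) (ac_integrable_oo acb)).
have [G1 dG1] : exists G : R -> R, forall c d, 0 < c ->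
    acd c d G (fun x => q x * Re (A x) + Re (B x)).
  apply: global_primitive => c d; apply: iqAB => c0 d0.
  by have [] := acAB c d c0 d0.
have [G2 dG2] : exists G : R -> R, forall c d, 0 < c ->
    acd c d G (fun x => q x * Im (A x) + Im (B x)).
  apply: global_primitive => c d; apply: iqAB => c0 d0.
  by have [] := acAB c d c0 d0.
pose g x : R[i] := G1 x +i* G2 x.
have dg c d : 0 < c -> acdC c d g g'.
  move=> c0; split.
    by apply: (acd_eq (dG1 c d c0)) => x _; rewrite /g'; move: (A x) (B x) => y y'; rewrite !ReImE /=; ring.
  by apply: (acd_eq (dG2 c d c0)) => x _; rewrite /g'; move: (A x) (B x) => y y'; rewrite !ReImE /=; ring.
pose v x := - (conjc (p x) * (E x)^-1) + g x * u x.
pose w x := conjc (u x) * (E x)^-1 + g x * p x.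
exists v, w; split.
  move=> c d cb db; have [c0 _] := cb; have [d0 _] := db.
  have [du dp] := su cb db; split.
  - apply: (acdC_eq (acdCD (acdCN (acdCM (acdC_conj dp) (dV c d c0 d0)))
                           (acdCM (dg c d c0) du))) => x /andP[cx _].
    have := E0 x (lt_trans c0 cx).
    rewrite /w /v /g' /A /B /E' /E !conjcM conjcB conjcR.
    move: (g x) (u x) (p x) (conjc (u x)) (conjc (p x)) (conjc z) (q x)%:C =>
      a1 a2 a3 a4 a5 a6 a7 e0.
    by field.
  - apply: (acdC_eq (acdCD (acdCM (acdC_conj du) (dV c d c0 d0))
                           (acdCM (dg c d c0) dp))) => x /andP[cx _].
    have := E0 x (lt_trans c0 cx).
    rewrite /w /v /g' /A /B /E' /E.
    move: (g x) (u x) (p x) (conjc (u x)) (conjc (p x)) (conjc z) (q x)%:C =>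
      a1 a2 a3 a4 a5 a6 a7 e0.
    by field.
move=> x x0; have := E0 x x0; rewrite /wronskian /w /v /E.
move: (g x) (u x) (p x) (conjc (u x)) (conjc (p x)) => a1 a2 a3 a4 a5 e0.
by field.
Qed.

End second_solution.

(** * Behaviour at the right end point *)

Section square_integrability.
Context {R : realType}.
Local Notation mu := (@lebesgue_measure R).
Local Notation Re := complex.Re.
Local Notation Im := complex.Im.
Implicit Types (q : R -> R) (z : R[i]) (u p v w : R -> R[i]) (c d x : R).

Lemma nondecreasing_cvg_pinfty (f : R -> R) r B :
  (forall s t, r <= s -> s <= t -> f s <= f t) -> (forall t, r <= t -> f t <= B) ->
  exists l : R, f x @[x --> +oo%R] --> l.
Proof.
move=> ndf fB; pose g t := f (Num.max t r).
have gcvg : g x @[x --> +oo%R] --> sup (range g).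
  apply: nondecreasing_cvgr.
    move=> s t st; apply: ndf; first by rewrite le_max lexx orbT.
    by rewrite ge_max !le_max st lexx orbT.
  by exists B => _ [t _ <-]; apply: fB; rewrite le_max lexx orbT.
exists (sup (range g)); apply: cvg_trans gcvg; apply: near_eq_cvg.
near=> t; rewrite /g max_l//; near: t; exact: nbhs_pinfty_ge.
Unshelve. all: by end_near. Qed.

Variables (q : R -> R) (z : R[i]) (u p : R -> R[i]).
Hypothesis su : local_solution q +oo%E z u p.
Hypothesis z0 : 0 < Im z.

Lemma ac_nsq_solution c d : 0 < c -> 0 < d -> ac c d (fun x => nsq (u x)).
Proof.
by move=> /itv0y cb /itv0y db; have [du _] := su cb db; have [] := acd_nsq du.
Qed.

Lemma flux_integral c d : 0 < c -> c <= d ->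
  flux u p c - flux u p d = Im z * \int[mu]_(x in `]c, d[) nsq (u x).
Proof.
move=> c0 cd; have d0 := lt_le_trans c0 cd.
have [F dF FE] := primitive_ac (ac_nsq_solution c0 d0).
rewrite -FE//; have dG := acdD (acd_flux su (itv0y c0) (itv0y d0)) (acdZ (Im z) dF).
have H1 : flux u p d + Im z * F d <= flux u p c + Im z * F c.
  by apply: (acd_nincr cd dG) => x _; rewrite mulNr addNr.
have H2 : flux u p c + Im z * F c <= flux u p d + Im z * F d.
  by apply: (acd_ndecr cd dG) => x _; rewrite mulNr addNr.
by rewrite mulrBr; lra.
Qed.

(** From r to t the flux loses Im z times the integral of |u|^2. For solutions, square integrability
    at infinity thus amounts to a lower bound on the flux; [flux_bounded_L2] is the converse. *)
Lemma L2_flux_bounded : L2_at_infty u ->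
  exists2 r, 0 < r & exists B, forall t, r <= t -> B <= flux u p t.
Proof.
move=> [r r0 ir]; exists r => //.
exists (flux u p r - Im z * \int[mu]_(x in `[r, +oo[) (normc (u x) ^+ 2)) => t rt.
suff : Im z * \int[mu]_(x in `]r, t[) nsq (u x) <=
       Im z * \int[mu]_(x in `[r, +oo[) (normc (u x) ^+ 2).
  by rewrite -flux_integral//; lra.
rewrite ler_pM2l//.
have sub : `]r, t[ `<=` `[r, +oo[.
  by move=> y /=; rewrite !in_itv/= => /andP[/ltW -> _].
have irt : mu.-integrable `]r, t[ (fun x => (normc (u x) ^+ 2)%:E).
  exact: integrableS ir.
rewrite /Rintegral fine_le//.
- by under eq_integral do rewrite -sqr_normc; exact: (@integrable_fin_num _ _ R
  mu _ _ _ irt).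
- exact: (@integrable_fin_num _ _ R mu _ _ _ ir).
- under eq_integral do rewrite -sqr_normc.
  apply: ge0_subset_integral => //.
  + by case/integrableP : ir.
  + by move=> x _; rewrite lee_fin sqr_ge0.
Qed.

Lemma flux_bounded_L2 r B : 0 < r -> (forall t, r <= t -> B <= flux u p t) ->
  L2_at_infty u.
Proof.
move=> r0 HB; exists r => //.
(* An antiderivative of |u|^2, bounded above because the flux is bounded below. *)
pose F x := - (Im z)^-1 * flux u p x.
have nF s t : 0 < s -> s <= t -> F s <= F t.
  move=> s0 st; rewrite /F !mulNr lerN2 ler_pM2l ?invr_gt0//.
  have t0 := lt_le_trans s0 st.
  exact: (flux_nincr su (ltW z0) (itv0y s0) (itv0y t0) st).
have dF x : 0 < x -> is_derive x 1 F (nsq (u x)).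
  move=> x0; have x20 : 0 < x / 2 by rewrite divr_gt0.
  have x10 : 0 < x + 1 by rewrite addr_gt0.
  have dF := acdZ (- (Im z)^-1) (acd_flux su (itv0y x20) (itv0y x10)).
  have dF' : acd (x / 2) (x + 1) F (fun x => nsq (u x)).
    by apply: (acd_eq dF) => y _; rewrite mulrA mulrNN mulVf ?mul1r// gt_eqF.
  apply: acd_is_derive dF' _ _; first exact: ac_nsq_solution.
  by apply/andP; split; lra.
have [l Fl] : exists l : R, F x @[x --> +oo%R] --> l.
  apply: (@nondecreasing_cvg_pinfty _ r (- (Im z)^-1 * B)).
    by move=> s t rs; apply: nF; exact: lt_le_trans rs.
  by move=> t rt; rewrite /F !mulNr lerN2 ler_pM2l ?invr_gt0// HB.
have cu : {within `[r, +oo[, continuous (fun x => nsq (u x))}.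
  apply: derivable_within_continuous => x; rewrite in_itv/= andbT => rx.
  have x0 := lt_le_trans r0 rx; have x20 : 0 < x / 2 by rewrite divr_gt0.
  have x10 : 0 < x + 1 by rewrite addr_gt0.
  have [du dp] := su (itv0y x20) (itv0y x10).
  have dn := acd_nsq du.
  have acn : ac (x / 2) (x + 1) (fun x => 2 * (Re (u x) * Re (p x) + Im (u x) *
    Im (p x))).
    by have [] := acdZ 2 (acdD (acdM du.1 dp.1) (acdM du.2 dp.2)).
  have xx : x / 2 < x < x + 1 by apply/andP; split; lra.
  by have H := acd_is_derive dn acn xx; exact: ex_derive.
have -> : (fun x => (normc (u x) ^+ 2)%:E) = EFin \o (fun x => nsq (u x)).
  by apply/funext => x; rewrite /= sqr_normc.
apply/integrableP; split.
  apply/measurable_EFinP; exact: subspace_continuous_measurable_fun.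
under eq_integral do rewrite gee0_abs ?lee_fin ?nsq_ge0//.
rewrite (@ge0_continuous_FTC2y R (fun x => nsq (u x)) F r l)//.
- by rewrite -EFinB ltry.
- by move=> x _; exact: nsq_ge0.
- by move=> x rx; have H := dF x (lt_trans r0 rx); exact: ex_derive.
- apply: cvg_at_right_filter.
  have := dF r r0 => dFr.
  by have /derivable1_diffP/differentiable_continuous := @ex_derive _ _ _ _ _ _
    _ dFr.
- move=> x; rewrite in_itv/= andbT => rx; rewrite derive1E.
  by have := dF x (lt_trans r0 rx) => dFx; rewrite derive_val.
Qed.

End square_integrability.

(** * Flux at a finite end point, and Weyl's nested discs *)

Section boundary_flux.
Context {R : realType}.
Local Notation mu := (@lebesgue_measure R).
Local Notation Re := complex.Re.
Local Notation Im := complex.Im.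
Implicit Types (q : R -> R) (z : R[i]) (u p v w : R -> R[i]) (c d x : R) (b :
  \bar R).

Lemma local_solution_lin q b z u p v w (k : R[i]) :
  local_solution q b z u p -> local_solution q b z v w ->
  local_solution q b z (fun x => v x + k * u x) (fun x => w x + k * p x).
Proof.
move=> su sv c d cb db; have [du dp] := su c d cb db; have [dv dw] := sv c d cb db.
split; first exact: acdCD dv (acdCZ k du).
by apply: (acdC_eq (acdCD dw (acdCZ k dp))) => x _; ring.
Qed.

Lemma solution_energy_neq0 q b z u p : local_solution q b z u p ->
  (forall d, in_itv0 b d -> mu.-integrable `]0, d[ (EFin \o q)) ->
  nonzero_on b u -> forall x, in_itv0 b x -> u x != 0 \/ p x != 0.
Proof.
move=> su iq [y yb uy] x xb; apply/orP; rewrite -negb_and;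
  apply/negP => /andP[/eqP ux /eqP px].
by have [/eqP] := solution_eq0 su iq xb ux px yb; rewrite (negbTE uy).
Qed.

(** Since h is real, the boundary values satisfy Im (conj ub ub') = 0. The flux tends to 0 at b and
    is nonincreasing, so it is nonnegative before. *)
Lemma flux_ge0_finite q (b : R) h z u : solves q b%:E z u -> 0 < Im z ->
  boundary_condition (Finite_end b h) u ->
  forall x, in_itv0 b%:E x -> 0 <= flux u (deriveC u) x.
Proof.
move=> sol z0 [ub [ub' [[ur ui] [pr pim] bc]]] x xb; have su := solves_local sol.
have fl : flux u (deriveC u) t @[t --> b^'-] --> (0 : R).
  have -> : flux u (deriveC u) = (fun t => Re (u t) * Im (deriveC u t) - Im (u
    t) * Re (deriveC u t)).
    by apply/funext => t; rewrite /flux !ReImE /=; ring.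
  have -> : 0 = Re ub * Im ub' - Im ub * Re ub'.
    case: h bc => [h bc|->]; last by rewrite /= !mul0r subrr.
    have -> : ub' = - (h%:C * ub) by apply/eqP; rewrite -addr_eq0 bc.
    by rewrite !ReImE /=; ring.
  by apply: cvgB; apply: cvgM.
rewrite leNgt; apply/negP => fx.
have xltb : x < b by case: xb.
have x0 : 0 < x by case: xb.
have e0 : 0 < - flux u (deriveC u) x by rewrite oppr_gt0.
have /cvgrPdist_lt /(_ _ e0) H := fl.
near b^'- => t.
have : `|0 - flux u (deriveC u) t| < - flux u (deriveC u) x by near: t.
have xt : x < t by near: t; exact: nbhs_left_gt.
have tb : t < b by near: t; exact: nbhs_left_lt.
have : flux u (deriveC u) t <= flux u (deriveC u) x.
  apply: (flux_nincr su (ltW z0) xb _ (ltW xt)).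
  by split => //; exact: lt_trans xt.
rewrite sub0r normrN => ftx; have := ler_norm (- flux u (deriveC u) t).
by rewrite normrN; lra.
Unshelve. all: by end_near. Qed.

Section half_line.
Variable q : R -> R.

(* With [U = flux u p N < 0], the solutions [v + a u] of nonnegative flux at [N]
   are those with [a] in a disc of radius [-1/(2U)] (Weyl's discs). The discs
   are nested, so that their centres converge to a common point. *)
Lemma weyl_solution z u p v w x1 : 0 < Im z -> 0 < x1 ->
  local_solution q +oo%E z u p -> local_solution q +oo%E z v w ->
  (forall x, 0 < x -> wronskian u p v w x = 1) -> flux u p x1 < 0 ->
  exists k, forall x, x1 <= x ->
    0 <= flux (fun t => v t + k * u t) (fun t => w t + k * p t) x.
Proof.
move=> z0 x10 su sv wr1 f1.
pose U x := flux u p x; pose V x := flux v w x.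
pose X x := Im (conjc (v x) * p x + conjc (u x) * w x).
pose Y x := Re (conjc (v x) * p x - conjc (u x) * w x).
pose Phi (a b x : R) := flux (fun t => v t + (a +i* b) * u t) (fun t => w t +
  (a +i* b) * p t) x.
have PhiE (a b x : R) : Phi a b x = V x + (a ^+ 2 + b ^+ 2) * U x + a * X x + b
  * Y x.
  rewrite /Phi /V /U /X /Y /flux !ReImE /=; ring.
(* The discriminant of the quadratic [Phi] is the squared modulus of the Wronskian. Completing the
   square then gives the radius. *)
have UXY x : 0 < x -> X x ^+ 2 + Y x ^+ 2 - 4 * U x * V x = 1.
  move=> /wr1 H; have := congr1 (fun k => nsq k) H.
  rewrite /wronskian {2}/nsq /= expr1n expr0n addr0 => E1; rewrite -[RHS]E1.
  by rewrite /X /Y /U /V /flux /nsq !ReImE; ring.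
have Phid (a b s t : R) : 0 < s -> s <= t -> Phi a b t <= Phi a b s.
  move=> s0 st; apply: (flux_nincr (local_solution_lin (a +i* b) su sv) (ltW
    z0) _ _ st).
    exact: itv0y.
  by apply: itv0y; exact: lt_le_trans st.
have U0 x : x1 <= x -> U x < 0.
  move=> x1x; apply: le_lt_trans f1; apply: (flux_nincr su (ltW z0)) => //.
    exact: itv0y.
  by apply: itv0y; exact: lt_le_trans x1x.
pose r x := - (2 * U x)^-1; pose c1 x := - X x / (2 * U x);
  pose c2 x := - Y x / (2 * U x).
have r0 x : x1 <= x -> 0 < r x.
  by move=> /U0 ?; rewrite /r oppr_gt0 invr_lt0; lra.
have Phi2 (a b x : R) : x1 <= x ->
    Phi a b x = U x * ((a - c1 x) ^+ 2 + (b - c2 x) ^+ 2 - r x ^+ 2).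
  move=> x1x; rewrite PhiE /c1 /c2 /r; have := UXY x (lt_le_trans x10 x1x).
  have := U0 x x1x; move: (U x) (V x) (X x) (Y x) => U' V' X' Y' U'0 E.
  have V'E : V' = (X' ^+ 2 + Y' ^+ 2 - 1) / (4 * U').
    have -> : X' ^+ 2 + Y' ^+ 2 - 1 = 4 * U' * V' by lra.
    by field; lra.
  by rewrite V'E; field; lra.
have disc (a b s t : R) : x1 <= s -> s <= t ->
    (a - c1 t) ^+ 2 + (b - c2 t) ^+ 2 <= r t ^+ 2 ->
    (a - c1 s) ^+ 2 + (b - c2 s) ^+ 2 <= r s ^+ 2.
  move=> x1s st H; have := Phid a b s t (lt_le_trans x10 x1s) st.
  rewrite !Phi2//; last exact: le_trans st.
  have := U0 s x1s; have := U0 t (le_trans x1s st); nra.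
have coord (x y : R) : 0 <= y -> x ^+ 2 <= y ^+ 2 -> - y <= x <= y.
  by move=> y0 xy; apply/andP; split; nra.
(* The leftmost point of the disc at t lies in the disc at s, so left ends move to the right; [inc2]
   uses lowest points. As the radii decrease too, the centres converge. *)
have inc1 s t : x1 <= s -> s <= t -> c1 s - r s <= c1 t - r t.
  move=> x1s st; have x1t := le_trans x1s st.
  have H : (c1 t - r t - c1 t) ^+ 2 + (c2 t - c2 t) ^+ 2 <= r t ^+ 2.
    by rewrite le_eqVlt; apply/orP; left; apply/eqP; ring.
  have {}H := disc _ _ s t x1s st H.
  have := coord (c1 t - r t - c1 s) (r s) (ltW (r0 s x1s)).
  by have := sqr_ge0 (c2 t - c2 s) => ? /(_ _)/andP[|]; lra.
have inc2 s t : x1 <= s -> s <= t -> c2 s - r s <= c2 t - r t.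
  move=> x1s st; have x1t := le_trans x1s st.
  have H : (c1 t - c1 t) ^+ 2 + (c2 t - r t - c2 t) ^+ 2 <= r t ^+ 2.
    by rewrite le_eqVlt; apply/orP; left; apply/eqP; ring.
  have {}H := disc _ _ s t x1s st H.
  have := coord (c2 t - r t - c2 s) (r s) (ltW (r0 s x1s)).
  by have := sqr_ge0 (c1 t - c1 s) => ? /(_ _)/andP[|]; lra.
have decr s t : x1 <= s -> s <= t -> r t <= r s.
  move=> x1s st; have x1t := le_trans x1s st.
  have Us := U0 s x1s; have Ut := U0 t x1t.
  have : U t <= U s.
    apply: (flux_nincr su (ltW z0)) => //; apply: itv0y; exact: lt_le_trans x10 _.
  by move=> Uts; rewrite /r -!invrN lef_pV2 ?posrE; lra.
have cen s : x1 <= s -> (c1 s - c1 x1) ^+ 2 + (c2 s - c2 x1) ^+ 2 <= r x1 ^+ 2.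
  move=> x1s; apply: (disc _ _ x1 s) => //.
  by rewrite !subrr expr0n addr0 sqr_ge0.
have [l1 Hl1] : exists l : R, c1 x - r x @[x --> +oo%R] --> l.
  apply: (nondecreasing_cvg_pinfty (r := x1) (B := c1 x1 + r x1)) inc1 _ => x x1x.
  have := coord (c1 x - c1 x1) (r x1) (ltW (r0 x1 (lexx _))).
  by have := sqr_ge0 (c2 x - c2 x1); have := cen x x1x;
    have := r0 x x1x => ? ? ? /(_ _)/andP[|]; lra.
have [l2 Hl2] : exists l : R, c2 x - r x @[x --> +oo%R] --> l.
  apply: (nondecreasing_cvg_pinfty (r := x1) (B := c2 x1 + r x1)) inc2 _ => x x1x.
  have := coord (c2 x - c2 x1) (r x1) (ltW (r0 x1 (lexx _))).
  by have := sqr_ge0 (c1 x - c1 x1); have := cen x x1x;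
    have := r0 x x1x => ? ? ? /(_ _)/andP[|]; lra.
have [l3 Hl3] : exists l : R, - r x @[x --> +oo%R] --> l.
  apply: (nondecreasing_cvg_pinfty (r := x1) (B := 0)).
    by move=> s t x1s st; rewrite lerN2; exact: decr.
  by move=> t /r0 rt; rewrite oppr_le0 ltW.
have Hc1 : c1 x @[x --> +oo%R] --> l1 - l3.
  have -> : c1 = (fun x => c1 x - r x - (- r x)) by apply/funext => x; ring.
  exact: cvgB Hl1 Hl3.
have Hc2 : c2 x @[x --> +oo%R] --> l2 - l3.
  have -> : c2 = (fun x => c2 x - r x - (- r x)) by apply/funext => x; ring.
  exact: cvgB Hl2 Hl3.
exists ((l1 - l3) +i* (l2 - l3)) => x x1x.
suff H : ((l1 - l3) - c1 x) ^+ 2 + ((l2 - l3) - c2 x) ^+ 2 <= r x ^+ 2.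
  have := Phi2 (l1 - l3) (l2 - l3) x x1x; rewrite /Phi => ->.
  by rewrite nmulr_rge0 ?U0// subr_le0.
(* The disc at x is closed and contains all later centres, hence also their limit. *)
have HN : (fun N => (c1 N - c1 x) * (c1 N - c1 x) + (c2 N - c2 x) * (c2 N - c2 x)) N
    @[N --> +oo%R] --> ((l1 - l3) - c1 x) * ((l1 - l3) - c1 x) +
                       ((l2 - l3) - c2 x) * ((l2 - l3) - c2 x).
  have d1 : c1 N - c1 x @[N --> +oo%R] --> (l1 - l3) - c1 x by apply: cvgB Hc1
    _; exact: cvg_cst.
  have d2 : c2 N - c2 x @[N --> +oo%R] --> (l2 - l3) - c2 x by apply: cvgB Hc2
    _; exact: cvg_cst.
  by apply: cvgD; apply: cvgM.
rewrite !expr2; apply: (cvgr_to_le HN).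
near=> N; have xN : x <= N by near: N; apply: nbhs_pinfty_ge; rewrite num_real.
have H : (c1 N - c1 N) ^+ 2 + (c2 N - c2 N) ^+ 2 <= r N ^+ 2.
  by rewrite !subrr expr0n addr0 sqr_ge0.
by have := disc _ _ x N x1x xN H; rewrite !expr2.
Unshelve. all: by end_near. Qed.

End half_line.
End boundary_flux.

(** * Flux in the limit point and limit circle cases *)

Section half_line_flux.
Context {R : realType}.
Local Notation mu := (@lebesgue_measure R).
Local Notation Re := complex.Re.
Local Notation Im := complex.Im.
Implicit Types (z : R[i]) (u p v w : R -> R[i]) (c d x : R).
Variable q : R -> R.
Hypothesis iq : forall d, in_itv0 +oo%E d -> mu.-integrable `]0, d[ (EFin \o q).

Lemma local_solution_eq0 z v w : local_solution q +oo%E z v w ->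
  (forall x, 0 < x -> v x = 0) -> forall x, 0 < x -> w x = 0.
Proof.
move=> sv v0 x x0; have x20 : 0 < x / 2 by rewrite divr_gt0.
have x10 : 0 < x + 1 by rewrite addr_gt0.
have [[dr di] [[wronskian _] [wi _]]] := sv _ _ (itv0y x20) (itv0y x10).
have xx : x / 2 < x < x + 1 by apply/andP; split; lra.
apply: complexE.
- apply: (is_derive_loc_cst (k := 0) xx _ (acd_is_derive dr wronskian xx)) => t
  /andP[tx _].
  by rewrite v0// (lt_trans x20).
- apply: (is_derive_loc_cst (k := 0) xx _ (acd_is_derive di wi xx)) => t
  /andP[tx _].
  by rewrite v0// (lt_trans x20).
Qed.

(** If the flux were negative at x, some v + k u would have nonnegative flux from x on and so be
    square integrable. By the limit point property it would be a multiple of u, against the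
    Wronskian 1 of u and v. *)
Lemma flux_ge0_limit_point z u : Defs.limit_point q -> 0 < Im z ->
  solves q +oo%E z u -> nonzero_on +oo%E u -> L2_at_infty u ->
  forall x, in_itv0 +oo%E x -> 0 <= flux u (deriveC u) x.
Proof.
move=> lp z0 sol [y [y0 _] uy] L2u x [x0 _]; rewrite leNgt; apply/negP => fx.
have su := solves_local sol.
have up0 t : 0 < t -> u t != 0 \/ deriveC u t != 0.
  by move=> /itv0y; apply: (solution_energy_neq0 su iq); exists y => //;
    exact: itv0y.
have [v [w [sv wr1]]] := second_solution su iq up0.
have [k fk] := weyl_solution z0 x0 su sv wr1 fx.
have sf := local_solution_lin k su sv.
have L2f := flux_bounded_L2 sf z0 x0 fk.
have [solf _] := local_solution_solves sf.
have [u1 [_ _ _ u1P]] := lp z z0.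
have [c2 uE] := u1P u sol L2u; have [c1 fE] := u1P _ solf L2f.
have c20 : c2 != 0 by apply: contra_neq uy => c20; rewrite uE// c20 mul0r.
pose k' := c1 / c2.
have fu t : 0 < t -> v t + k * u t = k' * u t.
  by move=> t0; rewrite fE// [in RHS]uE// /k' mulrA divfK.
have sg := local_solution_lin (- k') su sf.
have g0 t : 0 < t -> w t + k * deriveC u t + - k' * deriveC u t = 0.
  apply: (local_solution_eq0 sg) => s s0 /=.
  by rewrite fu// mulNr subrr.
have := wr1 x x0; rewrite /wronskian.
have -> : v x = k' * u x - k * u x by rewrite -fu// addrK.
have -> : w x = k' * deriveC u x - k * deriveC u x.
  have /eqP := g0 x x0; rewrite mulNr subr_eq0 => /eqP <-.
  by rewrite addrK.
have -> : u x * (k' * deriveC u x - k * deriveC u x) -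
  deriveC u x * (k' * u x - k * u x) = 0 by ring.
by move/eqP; rewrite eq_sym oner_eq0.
Qed.

Lemma mul_le_nsqD (k y y' : R[i]) :
  `|Re (k * (y * y'))| <= normc k * (nsq y + nsq y') /\
  `|Im (k * (y * y'))| <= normc k * (nsq y + nsq y').
Proof.
have H : normc (k * (y * y')) <= normc k * (nsq y + nsq y').
  rewrite !normcM ler_wpM2l ?normcE ?sqrtr_ge0// -!normcE -!sqr_normc.
  have := sqr_ge0 (normc y - normc y'); have := sqr_ge0 (normc y);
    have := sqr_ge0 (normc y').
  lra.
by split; apply: le_trans H; [exact: normr_Re_le|exact: normr_Im_le].
Qed.

(** A combination G of the two fluxes is a primitive of K (|u|^2 + |v|^2) and is bounded above; F -
    G and - F - G are nonincreasing. The spectral parameters differ because Wronskians of solutions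
    at z and at [zi] are to be bounded. *)
Lemma dominated_bounded z1 z2 u p v w (F F' : R -> R) K r B : 0 <= K -> 0 < r ->
  0 < Im z1 -> 0 < Im z2 ->
  local_solution q +oo%E z1 u p -> local_solution q +oo%E z2 v w ->
  (forall t, r <= t -> B <= flux u p t) -> (forall t, r <= t -> B <= flux v w t) ->
  (forall d, 0 < d -> acd r d F F') ->
  (forall x, `|F' x| <= K * (nsq (u x) + nsq (v x))) ->
  exists M, forall t, r <= t -> `|F t| <= M.
Proof.
move=> K0 r0 z10 z20 su sv uB vB dF FK.
pose G x := - K * ((Im z1)^-1 * flux u p x + (Im z2)^-1 * flux v w x).
have dG d : 0 < d -> acd r d G (fun x => K * (nsq (u x) + nsq (v x))).
  move=> d0; have := acdZ (- K) (acdD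
    (acdZ (Im z1)^-1 (acd_flux su (itv0y r0) (itv0y d0)))
    (acdZ (Im z2)^-1 (acd_flux sv (itv0y r0) (itv0y d0)))).
  by move=> /acd_eq; apply => x _; field; rewrite !gt_eqF.
have Gub t : r <= t -> G t <= - K * ((Im z1)^-1 * B + (Im z2)^-1 * B).
  move=> rt; rewrite /G !mulNr lerN2 ler_wpM2l// lerD// ler_wpM2l ?invr_ge0
    ?(ltW z10) ?(ltW z20)//.
    exact: uB.
  exact: vB.
exists (`|F r| + (- K * ((Im z1)^-1 * B + (Im z2)^-1 * B) - G r)) => t rt.
have t0 := lt_le_trans r0 rt.
have := Gub t rt; set M := - K * _ => GM.
have H1 : F t - G t <= F r - G r.
  apply: (acd_nincr rt (acdB (dF t t0) (dG t t0))) => x _.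
  by rewrite subr_le0 (le_trans (ler_norm _)).
have H2 : - F t - G t <= - F r - G r.
  apply: (acd_nincr rt (acdB (acdN (dF t t0)) (dG t t0))) => x _.
  by rewrite subr_le0 (le_trans (ler_norm _))// normrN.
have := ler_norm (F r); have := ler_norm (- F r); rewrite normrN => ? ?.
by rewrite ler_norml; apply/andP; split; lra.
Qed.

(* The conclusion [4 W_u^2 <= ...] comes from the Pluecker relation
   [u0,v0][conj u,u] = [u0,conj u][v0,u] - [u0,u][v0,conj u] and from
   |[conj u,u0]|^2 = |[u,u0]|^2 + 4 W_u W_u0, where [f,g] = f g' - f' g and
   [W_f = Im (conj f f')]. *)
Lemma plucker_flux (U P U0 P0 V0 Q0 : R[i]) :
  U0 * Q0 - P0 * V0 = 1 ->
  let W := Im (conjc U * P) in let W0 := Im (conjc U0 * P0) in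
  W <= 0 -> 0 <= W0 ->
  4 * W ^+ 2 <= 2 * nsq (U0 * P - P0 * U) *
     (nsq (V0 * P - Q0 * U) + nsq (V0 * conjc P - Q0 * conjc U)).
Proof.
move=> wr1 W W0 Wn W0p.
set D := U0 * P - P0 * U; pose A := U0 * conjc P - P0 * conjc U.
set S := V0 * P - Q0 * U; set T := V0 * conjc P - Q0 * conjc U.
have pl : conjc U * P - conjc P * U = A * S - D * T.
  rewrite -[LHS]mul1r -wr1 /A /S /D /T; ring.
have nA : nsq A = nsq D + 4 * (W * W0).
  rewrite /A /D /W /W0 /nsq !ReImE; ring.
(* The opposite signs of W and W0 let the bracket with conj u be controlled by the one with u, which
   is the one the boundary condition sends to 0. *)
have AD : nsq A <= nsq D by rewrite nA; nra.
have -> : 4 * W ^+ 2 = nsq (A * S - D * T).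
  by rewrite -pl /nsq /W !ReImE; ring.
have par (y y' : R[i]) : nsq (y - y') <= 2 * (nsq y + nsq y').
  rewrite /nsq !ReImE; have := sqr_ge0 (Re y + Re y');
    have := sqr_ge0 (Im y + Im y'); lra.
apply: le_trans (par _ _) _; rewrite !nsqM.
have := nsq_ge0 S; have := nsq_ge0 T; have := nsq_ge0 D; nra.
Qed.

(** With v a second solution at [zi], the brackets S and T of v with u and conj u stay bounded,
    because u and v are square integrable. As D tends to 0, [plucker_flux] makes the flux tend to 0
    once it is negative, which its monotonicity forbids. *)
Lemma flux_ge0_limit_circle z zi u u0 : limit_circle q -> 0 < Im zi ->
  solves q +oo%E zi u0 -> nonzero_on +oo%E u0 -> dissipative_at_infty u0 -> 0 <
    Im z ->
  solves q +oo%E z u ->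
  cvgC (fun x => u0 x * deriveC u x - deriveC u0 x * u x) +oo%R 0 ->
  forall x, in_itv0 +oo%E x -> 0 <= flux u (deriveC u) x.
Proof.
move=> lc i0 sol0 [y [y0 _] u0y] [l l0 Wl] z0 sol [Dr Di] x1 [x10 _].
rewrite leNgt; apply/negP => fx1.
have su := solves_local sol; have su0 := solves_local sol0.
set p := deriveC u in fx1 su Dr Di *; set p0 := deriveC u0 in su0 Wl Dr Di *.
have up0 t : 0 < t -> u0 t != 0 \/ p0 t != 0.
  by move=> /itv0y; apply: (solution_energy_neq0 su0 iq); exists y => //;
    exact: itv0y.
have [v [w [sv wr1]]] := second_solution su0 iq up0.
have [solv _] := local_solution_solves sv.
have [r1 r10 [B1 uB]] := L2_flux_bounded su z0 (lc z z0 u sol).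
have [r2 r20 [B2 vB]] := L2_flux_bounded sv i0 (lc zi i0 v solv).
pose r := Num.max x1 (Num.max r1 r2).
have r0 : 0 < r by rewrite lt_max x10.
(* The flux of [u0] is nonincreasing, so it is at least its limit l >= 0. *)
have W0 t : 0 < t -> 0 <= flux u0 p0 t.
  move=> t0; apply: le_trans l0 _; apply: (cvgr_to_le Wl).
  near=> s; apply: (flux_nincr su0 (ltW i0) (itv0y t0)).
    apply: itv0y; near: s; apply: nbhs_pinfty_gt; rewrite num_real//.
  near: s; apply: nbhs_pinfty_ge; rewrite num_real//.
pose B := Num.min B1 B2.
have uB' t : r <= t -> B <= flux u p t.
  by rewrite !ge_max => /and3P[_ rt _]; rewrite ge_min uB.
have vB' t : r <= t -> B <= flux v w t.
  by rewrite !ge_max => /and3P[_ _ rt]; rewrite ge_min vB// orbT.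
pose S x := v x * p x - w x * u x.
pose T x := v x * conjc (p x) - w x * conjc (u x).
have dS d : 0 < d -> acdC r d S (fun x => (zi - z) * (v x * u x)).
  move=> d0; have [du dp] := su _ _ (itv0y r0) (itv0y d0).
  have [dv dw] := sv _ _ (itv0y r0) (itv0y d0).
  by apply: (acdC_eq (acdCB (acdCM dv dp) (acdCM dw du))) => x _; ring.
have dT d : 0 < d -> acdC r d T (fun x => (zi - conjc z) * (v x * conjc (u x))).
  move=> d0; have [du dp] := su _ _ (itv0y r0) (itv0y d0).
  have [dv dw] := sv _ _ (itv0y r0) (itv0y d0).
  apply: (acdC_eq (acdCB (acdCM dv (acdC_conj dp)) (acdCM dw (acdC_conj du))))
    => x _.
  by rewrite !conjcM conjcB conjcR; ring.
have nn (k : R[i]) : 0 <= normc k by rewrite normcE sqrtr_ge0.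
have bnd := dominated_bounded (nn _) r0 i0 z0 sv su vB' uB'.
have [M1 S1] := bnd _ _ _ (fun d (d0 : 0 < d) => proj1 (dS d d0))
   (fun x => proj1 (mul_le_nsqD (zi - z) (v x) (u x))).
have [M2 S2] := bnd _ _ _ (fun d (d0 : 0 < d) => proj2 (dS d d0))
   (fun x => proj2 (mul_le_nsqD (zi - z) (v x) (u x))).
have HT (x : R) : `|Re ((zi - conjc z) * (v x * conjc (u x)))| <= normc (zi -
  conjc z) * (nsq (v x) + nsq (u x)) /\
  `|Im ((zi - conjc z) * (v x * conjc (u x)))| <= normc (zi - conjc z) * (nsq
    (v x) + nsq (u x)).
  by rewrite -(nsq_conjc (u x)); exact: mul_le_nsqD.
have [M3 T1] := bnd _ _ _ (fun d (d0 : 0 < d) => proj1 (dT d d0)) (fun x =>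
  proj1 (HT x)).
have [M4 T2] := bnd _ _ _ (fun d (d0 : 0 < d) => proj2 (dT d d0)) (fun x =>
  proj2 (HT x)).
pose M := M1 ^+ 2 + M2 ^+ 2 + M3 ^+ 2 + M4 ^+ 2.
have sqb (a m : R) : `|a| <= m -> a ^+ 2 <= m ^+ 2.
  move=> am; rewrite -(real_normK (num_real a)) ler_sqr ?nnegrE//.
  exact: le_trans am.
have STM t : r <= t -> nsq (S t) + nsq (T t) <= M.
  move=> rt; have := sqb _ _ (S1 t rt); have := sqb _ _ (S2 t rt).
  have := sqb _ _ (T1 t rt); have := sqb _ _ (T2 t rt).
  by rewrite /nsq /M /S /T; lra.
pose D x := u0 x * p x - p0 x * u x.
have nD : nsq (D x) @[x --> +oo%R] --> (0 : R).
  have -> : (fun x => nsq (D x)) = (fun x => Re (D x) * Re (D x) + Im (D x) *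
    Im (D x)).
    by apply/funext => t; rewrite /nsq !expr2.
  rewrite [X in _ --> X](_ : _ = 0 * 0 + 0 * 0); last by rewrite mulr0 addr0.
  by apply: cvgD; apply: cvgM.
have M0 : 0 <= M by rewrite /M !addr_ge0// sqr_ge0.
(* Chosen so that nsq D < e gives 2 nsq D (nsq S + nsq T) <= 2 e M < 4 W(x1)^2. *)
pose e := 2 * flux u p x1 ^+ 2 / (M + 1).
have e0 : 0 < e.
  have f2 : 0 < flux u p x1 ^+ 2 by rewrite exprn_even_gt0//= lt_eqF.
  have M10 : 0 < M + 1 by lra.
  by rewrite /e divr_gt0// mulr_gt0.
have /cvgrPdist_lt /(_ _ e0) H := nD.
near (pinfty_nbhs R) => t.
have : `|0 - nsq (D t)| < e by near: t.
rewrite sub0r normrN ger0_norm ?nsq_ge0// => De.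
have rt : r <= t by near: t; apply: nbhs_pinfty_ge; rewrite num_real.
have t0 := lt_le_trans r0 rt.
have x1t : x1 <= t by apply: le_trans rt; rewrite le_max lexx.
have ft : flux u p t <= flux u p x1.
  exact: (flux_nincr su (ltW z0) (itv0y x10) (itv0y t0)).
have := plucker_flux (U := u t) (P := p t) (wr1 t t0) (_ : flux u p t <= 0) (W0
  t t0).
rewrite -/(D t) -/(S t) -/(T t) -/(flux u p t) => /(_ (le_trans ft (ltW fx1))).
have := STM t rt.
have : e * (M + 1) = 2 * flux u p x1 ^+ 2 by rewrite /e divfK// gt_eqF//; lra.
have := nsq_ge0 (D t); have := nsq_ge0 (S t); have := nsq_ge0 (T t).
move: (nsq (D t)) (nsq (S t)) (nsq (T t)) De => nd ns nt De nt0 ns0 nd0 eE stM.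
have ff : flux u p x1 ^+ 2 <= flux u p t ^+ 2.
  have : 0 <= (flux u p t - flux u p x1) * (flux u p t + flux u p x1).
    by rewrite mulr_le0//; lra.
  lra.
have H1 : nd * (ns + nt) <= nd * M by rewrite ler_wpM2l.
have H2 : nd * M <= e * M by rewrite ler_wpM2r// ltW.
lra.
Unshelve. all: by end_near. Qed.

End half_line_flux.

(** * Flux for potentials with uniformly integrable negative part *)

Section neg_part_end.
Context {R : realType}.
Local Notation mu := (@lebesgue_measure R).
Local Notation Re := complex.Re.
Local Notation Im := complex.Im.
Implicit Types (z : R[i]) (u p v w : R -> R[i]) (c d x : R).
Variable q : R -> R.
Hypothesis iq : forall d, in_itv0 +oo%E d -> mu.-integrable `]0, d[ (EFin \o q).

(* A Caccioppoli estimate on the window [N, N+1] with the cutoff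
   [phi t = (t - N) (N + 1 - t)]: the integral of [phi^2 |u'|^2] is bounded by
   that of [|u|^2], hence so is the flux. *)
Lemma window_flux z u p N K (g G : R -> R) c : 0 < Im z -> 0 < N -> 0 <= K -> 0
  < c ->
  local_solution q +oo%E z u p ->
  acd N (N + 1) G g -> (forall x, 0 <= g x) -> (forall x, 0 <= q x + g x) ->
  G (N + 1) - G N <= K ->
  (forall x, N <= x -> x <= N + 1 -> flux u p x <= - c) ->
  c <= (256 / 9) * (1 + 2 * (2 * (4 + `|Re z|) + 2 * K * (2 + 4 * (K + 1)))) *
       ((flux u p N - flux u p (N + 1)) / Im z).
Proof.
move=> z0 N0 K0 c0 su dG g0 qg GK fc.
have N10 : 0 < N + 1 by rewrite addr_gt0.
have [du dp] := su _ _ (itv0y N0) (itv0y N10).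
pose A x := nsq (u x); pose D x := nsq (p x).
pose P x := Re (u x) * Re (p x) + Im (u x) * Im (p x).
have dA : acd N (N + 1) A (fun x => 2 * P x) := acd_nsq du.
have dP : acd N (N + 1) P (fun x => D x + (q x - Re z) * A x).
  apply: (acd_eq (acdD (acdM du.1 dp.1) (acdM du.2 dp.2))) => x _.
  by rewrite !ReImE /D /A /nsq /=; ring.
have A0 x : 0 <= A x := nsq_ge0 _.
have D0 x : 0 <= D x := nsq_ge0 _.
have PAD x : P x ^+ 2 <= A x * D x.
  rewrite /P /A /D /nsq; have := sqr_ge0 (Re (u x) * Im (p x) - Im (u x) * Re
    (p x)); lra.
have WAD x : - flux u p x <= (A x + D x) / 2.
  rewrite /flux /A /D /nsq !ReImE.
  have := sqr_ge0 (Re (u x) + Im (p x)); have := sqr_ge0 (Im (u x) - Re (p x)); lra.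
pose phi x := (x - N) * (N + 1 - x).
have dphi : acd N (N + 1) phi (fun x => 2 * N + 1 - 2 * x).
  have id_ := acd_id N (N + 1).
  apply: (acd_eq (acdM (acdB id_ (acd_cst _ _ N)) (acdB (acd_cst _ _ (N + 1))
    id_))) => x _.
  by ring.
have phi2 : acd N (N + 1) (fun x => phi x * phi x) (fun x => 2 * phi x * (2 * N
  + 1 - 2 * x)).
  by apply: (acd_eq (acdM dphi dphi)) => x _; ring.
have phi01 x : N <= x -> x <= N + 1 -> 0 <= phi x <= 1.
  by move=> Nx xN; apply/andP; split; rewrite /phi; nra.
have acX : ac N (N + 1) (fun x => phi x * phi x * D x).
  by have [] := acdM phi2 (acd_nsq dp).
have [X dX _] := primitive_ac acX.
have X0 s t : N <= s -> s <= t -> t <= N + 1 -> X s <= X t.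
  move=> Ns st tN; apply: (acd_ndecr st (acd_sub Ns tN dX)) => x _.
  by rewrite mulr_ge0// -expr2 sqr_ge0.
pose V x := - (Im z)^-1 * flux u p x.
have dV : acd N (N + 1) V A.
  apply: (acd_eq (acdZ (- (Im z)^-1) (acd_flux su (itv0y N0) (itv0y N10)))) => x _.
  by rewrite mulrA mulrNN mulVf ?mul1r// gt_eqF.
have V0 s t : N <= s -> s <= t -> t <= N + 1 -> V s <= V t.
  by move=> Ns st tN; apply: (acd_ndecr st (acd_sub Ns tN dV)) => x _.
have -> : (flux u p N - flux u p (N + 1)) / Im z = V (N + 1) - V N.
  by rewrite /V; ring.
clearbody A D P V.
set Y := V (N + 1) - V N; pose XX := X (N + 1) - X N.
have Y0 : 0 <= Y by rewrite subr_ge0 V0//; lra.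
have XX0 : 0 <= XX by rewrite subr_ge0 X0//; lra.
(* Small enough for 2 K eta XX to be absorbed into XX / 2 at the end. *)
pose eta := (4 * (K + 1))^-1; have K10 : 0 < 4 * (K + 1) by lra.
have eta0 : 0 < eta by rewrite invr_gt0.
have e1 : eta * (4 * (K + 1)) = 1 by rewrite /eta mulVf// gt_eqF.
clearbody eta.
(* A bound for phi^2 |u|^2: integrate its derivative from N, where phi = 0, using 2 P <= 4 (K + 1) A
   + eta D. A pointwise bound is needed since only the integral of g is controlled. *)
pose S := (2 + 4 * (K + 1)) * Y + eta * XX.
have NN1 : N <= N + 1 by lra.
have sup t : N <= t -> t <= N + 1 -> phi t * phi t * A t <= S.
  move=> Nt tN.
  have dF := acdB (acdM phi2 dA) (acdD (acdZ (2 + 4 * (K + 1)) dV) (acdZ eta dX)).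
  have : phi t * phi t * A t - ((2 + 4 * (K + 1)) * V t + eta * X t) <=
         phi N * phi N * A N - ((2 + 4 * (K + 1)) * V N + eta * X N).
    apply: (acd_nincr Nt (acd_sub (lexx _) tN dF)) => x /andP[Nx xt].
    have xN : x <= N + 1 by lra.
    have /andP[p0 p1] := phi01 x (ltW Nx) xN.
    have b1 : 2 * phi x * (2 * N + 1 - 2 * x) <= 2 by nra.
    have b2 : 2 * P x <= 4 * (K + 1) * A x + eta * D x.
      have sq : (2 * P x) ^+ 2 <= (4 * (K + 1) * A x + eta * D x) ^+ 2.
        have := sqr_ge0 (4 * (K + 1) * A x - eta * D x).
        have -> : (4 * (K + 1) * A x + eta * D x) ^+ 2 =
          (4 * (K + 1) * A x - eta * D x) ^+ 2 + 4 * (eta * (4 * (K + 1))) * (A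
            x * D x) by ring.
        by rewrite e1; have := PAD x; lra.
      have rhs0 : 0 <= 4 * (K + 1) * A x + eta * D x.
        by rewrite addr_ge0// mulr_ge0// ltW.
      by nra.
    have pp : 0 <= phi x * phi x <= 1 by apply/andP; split; nra.
    have h1 : 2 * phi x * (2 * N + 1 - 2 * x) * A x <= 2 * A x by rewrite ler_wpM2r.
    have h2 : phi x * phi x * (2 * P x) <= phi x * phi x * (4 * (K + 1) * A x +
      eta * D x).
      by rewrite ler_wpM2l//; case/andP: pp.
    have h3 : phi x * phi x * (4 * (K + 1) * A x) <= 4 * (K + 1) * A x.
      have z1 : 0 <= 4 * (K + 1) * A x by apply: mulr_ge0 => //; exact: ltW.
      by rewrite ler_piMl//; case/andP: pp.
    lra.
  have : V t <= V (N + 1) by apply: V0.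
  have : X t <= X (N + 1) by apply: X0.
  have -> : phi N = 0 by rewrite /phi subrr mul0r.
  rewrite /S /Y /XX => Xt Vt H.
  have h1 : (2 + 4 * (K + 1)) * V t <= (2 + 4 * (K + 1)) * V (N + 1) by rewrite
    ler_wpM2l//; lra.
  have h2 : eta * X t <= eta * X (N + 1) by rewrite ler_wpM2l// ltW.
  lra.
have S0 : 0 <= S.
  by rewrite /S addr_ge0 ?mulr_ge0 ?(ltW eta0)//; lra.
(* Integrate (phi^2 P)': the boundary terms vanish with phi, and g enters only through S times its
   integral. *)
have cacc : XX <= 2 * (4 + `|Re z|) * Y + 2 * S * K.
  have dF := acdD (acdD (acdB (acdM phi2 dP) (acdZ 2^-1 dX)) (acdZ (4 + `|Re
    z|) dV)) (acdZ S dG).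
  have := acd_ndecr NN1 dF.
  have -> : phi N = 0 by rewrite /phi subrr mul0r.
  have -> : phi (N + 1) = 0 by rewrite /phi subrr mulr0.
  set Q := (forall x, _); suff : Q.
    move=> + H => /H {H}; rewrite /XX /Y => H.
    have : S * (G (N + 1) - G N) <= S * K by rewrite ler_wpM2l.
    lra.
  move=> x /andP[Nx xN]; have Nx' := ltW Nx; have xN' := ltW xN.
  have /andP[p0 p1] := phi01 x Nx' xN'.
  have b1 : - (2^-1 * (phi x * phi x * D x) + 2 * A x) <= 2 * phi x * (2 * N +
    1 - 2 * x) * P x.
    set y := 2 * phi x * (2 * N + 1 - 2 * x) * P x; set m := 2^-1 * _ + _.
    have m0 : 0 <= m.
      have := mulr_ge0 (mulr_ge0 p0 p0) (D0 x).
      by rewrite /m; have := A0 x; lra.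
    have sl : (2 * N + 1 - 2 * x) ^+ 2 <= 1 by nra.
    have y2 : y ^+ 2 <= m ^+ 2.
      have -> : y ^+ 2 = 4 * (phi x * phi x) * (2 * N + 1 - 2 * x) ^+ 2 * P x
        ^+ 2 by rewrite /y; ring.
      have -> : m ^+ 2 = (2^-1 * (phi x * phi x * D x) - 2 * A x) ^+ 2 +
                         4 * (phi x * phi x) * (A x * D x) by rewrite /m; field.
      have := sqr_ge0 (2^-1 * (phi x * phi x * D x) - 2 * A x).
      have h1 : (2 * N + 1 - 2 * x) ^+ 2 * P x ^+ 2 <= 1 * (A x * D x).
        by rewrite ler_pM ?sqr_ge0.
      have h2 : 4 * (phi x * phi x) * ((2 * N + 1 - 2 * x) ^+ 2 * P x ^+ 2) <=
                4 * (phi x * phi x) * (1 * (A x * D x)).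
        by rewrite ler_wpM2l//; have := mulr_ge0 p0 p0; lra.
      lra.
    by nra.
  have b2 := sup x Nx' xN'.
  have b3 : - (S * g x) <= phi x * phi x * (q x * A x).
    have h1 : 0 <= (phi x * phi x * A x) * (q x + g x).
      by rewrite mulr_ge0// mulr_ge0 ?A0//; exact: (mulr_ge0 p0 p0).
    have h2 : (phi x * phi x * A x) * g x <= S * g x by rewrite ler_wpM2r.
    lra.
  have b4 : phi x * phi x * (Re z * A x) <= `|Re z| * A x.
    have h1 : Re z * A x <= `|Re z| * A x by rewrite ler_wpM2r// ler_norm.
    have h2 : phi x * phi x * (Re z * A x) <= phi x * phi x * (`|Re z| * A x).
      by rewrite ler_wpM2l//; exact: (mulr_ge0 p0 p0).
    have h3 : phi x * phi x * (`|Re z| * A x) <= `|Re z| * A x.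
      rewrite ler_piMl//; last by apply: mulr_ile1.
      exact: mulr_ge0 (normr_ge0 _) (A0 x).
    lra.
  have := A0 x; have := D0 x; lra.
have XXY : XX <= 2 * (2 * (4 + `|Re z|) + 2 * K * (2 + 4 * (K + 1))) * Y.
  have h1 : 2 * (eta * XX) * K <= XX / 2.
    have : eta * K <= 4^-1 by lra.
    by move=> h; have : eta * K * XX <= 4^-1 * XX by [rewrite ler_wpM2r|]; lra.
  by move: cacc; rewrite /S; lra.
(* On the middle half of the window phi >= 3 / 16, hence phi^2 >= 9 / 256, while c <= - W <= (A + D)
   / 2. *)
have low : c * (9 / 256) / 2 <= (Y + XX) / 2.
  pose s := N + 4^-1; pose t := N + 3 / 4.
  have st : s <= t by rewrite /s /t; lra.
  have Ns : N <= s by rewrite /s; lra.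
  have tN : t <= N + 1 by rewrite /t; lra.
  have dF := acdB (acdD (acdZ 2^-1 dV) (acdZ 2^-1 dX)) (acdZ (c * (9 / 256))
    (acd_id N (N + 1))).
  have := acd_ndecr st (acd_sub Ns tN dF).
  set Q := (forall x, _); suff : Q.
    move=> + H => /H {H} /= H; have := V0 N s (lexx _) Ns (le_trans st tN).
    have := V0 t (N + 1) (le_trans Ns st) tN (lexx _).
    have := X0 N s (lexx _) Ns (le_trans st tN).
    have := X0 t (N + 1) (le_trans Ns st) tN (lexx _).
    have : t - s = 2^-1 by rewrite /t /s; field.
    by rewrite /Y /XX; nra.
  move=> x /andP[sx xt].
  have Nx : N <= x by apply: le_trans Ns _; exact: ltW.
  have xN : x <= N + 1 by apply: le_trans tN; exact: ltW.
  have /andP[p0 p1] := phi01 x Nx xN.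
  have p3 : 3 / 16 <= phi x.
    by move: sx xt; rewrite /s /t /phi => sx xt; nra.
  have pp : 9 / 256 <= phi x * phi x by nra.
  have pp1 : phi x * phi x <= 1 by rewrite mulr_ile1.
  have h1 := WAD x; have h2 := fc x Nx xN.
  have h3 : c * (9 / 256) <= phi x * phi x * c by rewrite mulrC ler_wpM2r// ltW.
  have h4 : phi x * phi x * c <= phi x * phi x * ((A x + D x) / 2).
    by rewrite ler_wpM2l//; [exact: (mulr_ge0 p0 p0)|lra].
  have h5 : phi x * phi x * A x <= A x by rewrite ler_piMl.
  lra.
set C1 := 2 * (4 + `|Re z|) + _ in XXY *.
lra.
Qed.

Lemma neg_part_integrable c d : 0 < c -> 0 < d ->
  mu.-integrable `]c, d[ (EFin \o (fun x => Num.max (- q x) 0)).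
Proof.
move=> c0 d0.
have iqcd : mu.-integrable `]c, d[ (EFin \o q).
  have := iq (itv0y d0); apply: integrableS => //.
  by apply: subset_itvr; rewrite bnd_simp ltW.
apply: (@le_integrable _ _ _ mu _ _ _ (EFin \o q)) => //.
- apply/measurable_EFinP; apply: measurable_maxr => //.
  apply: measurableT_comp => //.
  by case/integrableP : iqcd => /measurable_EFinP.
- move=> x _ /=; rewrite lee_fin; case: (leP (- q x) 0) => q0.
    by rewrite normr0.
  by rewrite normrN.
Qed.

(** For a square integrable u the flux converges, so its loss over [N, N + 1] tends to 0. Were it
    negative at x, [window_flux] would bound that loss below by a fixed positive number. *)
Lemma flux_ge0_neg_part z u : neg_part_unif_integrable q -> 0 < Im z ->
  solves q +oo%E z u -> L2_at_infty u ->
  forall x, in_itv0 +oo%E x -> 0 <= flux u (deriveC u) x.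
Proof.
move=> nq z0 sol L2u x [x0 _]; rewrite leNgt; apply/negP => fx.
have su := solves_local sol; set p := deriveC u in fx su.
have [r r0 [B uB]] := L2_flux_bounded su z0 L2u.
pose g y := Num.max (- q y) 0.
rewrite /neg_part_unif_integrable in nq; set SS := ereal_sup _ in nq.
have intS N : 0 < N -> (\int[mu]_(y in `]N, (N + 1)%R[) (g y)%:E <= SS)%E.
  by move=> N0; apply: ereal_sup_ubound; exists N => //=; rewrite in_itv/= N0.
have int0 N : (0 <= \int[mu]_(y in `]N, (N + 1)%R[) (g y)%:E)%E.
  by apply: integral_ge0 => y _; rewrite lee_fin le_max lexx orbT.
have SS0 : (0 <= SS)%E by apply: le_trans (int0 1) (intS 1 _).
have SSfin : SS \is a fin_num by rewrite ge0_fin_numE.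
pose K := fine SS; have K0 : 0 <= K by rewrite fine_ge0.
pose c := - flux u p x; have c0 : 0 < c by rewrite oppr_gt0.
set C := (256 / 9) * (1 + 2 * (2 * (4 + `|Re z|) + 2 * K * (2 + 4 * (K + 1)))).
have H N : x <= N -> c <= C * ((flux u p N - flux u p (N + 1)) / Im z).
  move=> xN; have N0 := lt_le_trans x0 xN; have N10 : 0 < N + 1 by rewrite addr_gt0.
  have [G dG GE] := primitive_acd (neg_part_integrable N0 N10).
  apply: (window_flux (G := G) (g := g)) => //.
  - by move=> y; rewrite le_max lexx orbT.
  - by move=> y; rewrite /g; case: (leP (- q y) 0); lra.
  - rewrite GE// ?lerDl// /K /Rintegral fine_le// ?intS//.
    exact: (@integrable_fin_num _ _ R mu _ _ _ (neg_part_integrable N0 N10)).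
  - move=> y Ny yN; rewrite /c opprK.
    have xy := le_trans xN Ny.
    exact: (flux_nincr su (ltW z0) (itv0y x0) (itv0y (lt_le_trans x0 xy)) xy).
have C0 : 0 < C.
  have rz := normr_ge0 (Re z).
  have k1 : 0 <= K * (2 + 4 * (K + 1)) by rewrite mulr_ge0//; lra.
  by rewrite /C mulr_gt0//; lra.
clearbody C.
have [l Hl] : exists l : R, - flux u p t @[t --> +oo%R] --> l.
  apply: (@nondecreasing_cvg_pinfty _ _ r (- B)) => [s t rs st|t /uB];
    rewrite lerN2//.
  have s0 := lt_le_trans r0 rs.
  exact: (flux_nincr su (ltW z0) (itv0y s0) (itv0y (lt_le_trans s0 st)) st).
(* Two values within e of the limit differ by at most 2 e, and C * (2 e / Im z) = c / 2. *)
pose e := c * Im z / (4 * C).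
have e0 : 0 < e by apply: divr_gt0; apply: mulr_gt0.
have /cvgrPdist_lt /(_ _ e0) [M [Mr HM]] := Hl.
pose N := Num.max x (M + 1).
have MN : M < N by rewrite lt_max ltrDl ltr01 orbT.
have MN1 : M < N + 1 by rewrite (lt_trans MN)// ltrDl.
have xN : x <= N by rewrite le_max lexx.
have := H N xN.
have := HM N MN; have := HM (N + 1) MN1.
rewrite /= !ltr_norml => /andP[h1 h2] /andP[h3 h4].
have d : flux u p N - flux u p (N + 1) <= 2 * e by lra.
apply/negP; rewrite -ltNge.
apply: (@le_lt_trans _ _ (C * (2 * e / Im z))).
  by rewrite ler_pM2l// ler_pM2r// invr_gt0.
have -> : C * (2 * e / Im z) = c / 2.
  by rewrite /e; field; rewrite !gt_eqF.
by lra.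
Qed.

End neg_part_end.

(** * Local bounds for the m-function *)

Section estimates.
Context {R : realType}.
Local Notation mu := (@lebesgue_measure R).
Local Notation Re := complex.Re.
Local Notation Im := complex.Im.
Implicit Types (q : R -> R) (z k : R[i]) (u p v w : R -> R[i]) (c d x : R) (b :
  \bar R).

(** Quadratic decay suffices: it only has to compensate the factor [nsq k] in [reflection_bound]. *)
Lemma expRN_le_sqrV (y : R) : 0 < y -> expR (- y) <= 4 / y ^+ 2.
Proof.
move=> y0; have y20 : 0 < y ^+ 2 by rewrite exprn_gt0.
have h : y / 2 <= expR (y / 2).
  by rewrite (le_trans _ (expR_ge1Dx _))// lerDr.
have H : y / 2 * (y / 2) <= expR y.
  have y2 : 0 <= y / 2 by rewrite divr_ge0// ltW.
  have -> : expR y = expR (y / 2) * expR (y / 2) by rewrite -expRD -splitr.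
  by rewrite ler_pM.
rewrite expRN ler_pdivlMr// mulrC ler_pdivrMr ?expR_gt0//; lra.
Qed.

Lemma acd_lip c d (f f' : R -> R) M : c <= d -> acd c d f f' ->
  (forall x, c < x < d -> `|f' x| <= M) -> `|f d - f c| <= M * (d - c).
Proof.
move=> cd df fM; rewrite ler_norml; apply/andP; split.
- have := acd_ndecr cd (acdD df (acdZ M (acd_id c d))).
  set Q := (forall x, _); suff : Q by move=> + H => /H; lra.
  by move=> x /fM; rewrite ler_norml => /andP[]; lra.
- have := acd_nincr cd (acdB df (acdZ M (acd_id c d))).
  set Q := (forall x, _); suff : Q by move=> + H => /H; lra.
  by move=> x /fM; rewrite ler_norml => /andP[]; lra.
Qed.

(** With rho = |Gamma|^2 one has rho' >= 4 Re k rho - |q| (rho + b2). An integrating factor gives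
    rho(x) <= exp(Q) (rho(x + r) exp(- 4 r Re k) + b2), and both terms are of order 1 / |k|^2. *)
Lemma reflection_bound q b k u p x r s (G : R -> R) Q : 0 < s -> 0 < r ->
  in_itv0 b x -> in_itv0 b (x + r) ->
  0 < Re k -> 0 < - Im k ->
  s ^+ 2 * nsq k <= Re k ^+ 2 -> s ^+ 2 * nsq k <= Im k ^+ 2 ->
  local_solution q b (- k ^+ 2) u p ->
  (forall y, x <= y -> y <= x + r -> 0 < flux u p y) ->
  acd x (x + r) G (fun y => `|q y|) -> G (x + r) - G x <= Q ->
  nsq ((p x + k * u x) / (p x - k * u x)) * nsq k <=
    expR Q * ((2 + 8 / s ^+ 2) / (4 * s ^+ 2 * r ^+ 2) + 4 / s ^+ 4).
Proof.
move=> s0 r0 xb xrb kr ki skr ski su fl dG GQ.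
have xr : x <= x + r by rewrite lerDl ltW.
have [du dp] := su _ _ xb xrb.
pose w y := p y - k * u y; pose v y := p y + k * u y.
(* Both terms are nonnegative as Im k < 0. So w does not vanish and |w| >= |Im k| |u|, whatever the
   size of m. *)
have Imw y : Im (conjc (u y) * w y) = flux u p y - Im k * nsq (u y).
  by rewrite /w /flux !ReImE /nsq; ring.
have wu y : x <= y -> y <= x + r -> Im k ^+ 2 * nsq (u y) <= nsq (w y) /\ 0 <
  nsq (w y).
  move=> xy yr.
  have h1 : Im (conjc (u y) * w y) ^+ 2 <= nsq (u y) * nsq (w y).
    by rewrite -(nsq_conjc (u y)) -nsqM [leRHS]/nsq lerDr sqr_ge0.
  have h0 := nsq_ge0 (u y); have hw := nsq_ge0 (w y); have hf := fl y xy yr.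
  have h2 : 0 <= - Im k * nsq (u y) by rewrite mulr_ge0// ltW.
  have h3 : 0 < Im (conjc (u y) * w y) by rewrite Imw; lra.
  have up : 0 < nsq (u y).
    rewrite lt_neqAle h0 andbT; apply/eqP => e0.
    by have := exprn_gt0 2 h3; move: h1; rewrite -e0 mul0r; lra.
  have h4 : (- Im k * nsq (u y)) ^+ 2 <= nsq (u y) * nsq (w y).
    apply: le_trans h1; rewrite ler_sqr ?nnegrE ?(ltW h3)//.
    by rewrite Imw; lra.
  have h5 : Im k ^+ 2 * nsq (u y) <= nsq (w y).
    rewrite -(ler_pM2l up); apply: le_trans h4.
    by rewrite le_eqVlt; apply/orP; left; apply/eqP; ring.
  split => //; apply: lt_le_trans h5; rewrite mulr_gt0//.
  by rewrite -sqrrN exprn_gt0.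
have w0 y : x <= y -> y <= x + r -> w y != 0.
  by move=> xy yr; rewrite -nsq_gt0; have [] := wu y xy yr.
pose Gam y := v y * (w y)^-1.
have dw := acdCB dp (acdCZ k du); have dv := acdCD dp (acdCZ k du).
(* This is (Gamma - 1)^2 / (2 k), because Gamma - 1 = 2 k u / w. *)
pose Y y := 2 * k * (u y * (w y)^-1) ^+ 2.
have dGam : acdC x (x + r) Gam (fun y => 2 * k * Gam y - (q y)%:C * Y y).
  apply: (acdC_eq (acdCM dv (acdCV w0 dw))) => y /andP[xy yr].
  have := w0 y (ltW xy) (ltW yr); rewrite /Gam /Y -/(w y) -/(v y).
  have -> : p y = w y + k * u y by rewrite /w subrK.
  have -> : v y = w y + 2 * k * u y by rewrite /w /v; ring.
  by move: (w y) (u y) (q y)%:C => w' u' q' w'0; field.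
have n0 : 0 < nsq k by rewrite /nsq ltr_pwDl ?sqr_ge0// exprn_gt0.
have k20 : 0 < Im k ^+ 2 by rewrite -sqrrN exprn_gt0.
have uw y : x <= y -> y <= x + r -> nsq (u y * (w y)^-1) <= (Im k ^+ 2)^-1.
  move=> xy yr; have [h1 h2] := wu y xy yr.
  rewrite nsqM nsqV ?w0// ler_pdivrMr// -(ler_pM2l k20) mulrA divff ?gt_eqF// mul1r.
  exact: h1.
have nsq2 : nsq (2 * k) = 4 * nsq k by rewrite /nsq !ReImE /=; ring.
pose b2 := 4 * nsq k / (Im k ^+ 2) ^+ 2.
have b20 : 0 <= b2.
  by apply: divr_ge0; [apply: mulr_ge0 => //; exact: ltW|exact: sqr_ge0].
have nY y : x <= y -> y <= x + r -> nsq (Y y) <= b2.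
  move=> xy yr; have := uw y xy yr; rewrite /Y /b2; move: (u y * _) => t ht.
  have -> : nsq (2 * k * t ^+ 2) = 4 * nsq k * nsq t ^+ 2.
    by rewrite nsqM nsq2 expr2 nsqM -expr2.
  have k4 : 0 <= 4 * nsq k by rewrite mulr_ge0// ltW.
  apply: (ler_wpM2l k4); rewrite -exprVn ler_sqr ?nnegrE ?nsq_ge0//.
  by rewrite invr_ge0 sqr_ge0.
pose rho y := nsq (Gam y).
have drho := acd_nsq dGam.
have rho'E y : x <= y -> y <= x + r ->
    4 * Re k * rho y - `|q y| * (rho y + b2) <=
    2 * (Re (Gam y) * Re (2 * k * Gam y - (q y)%:C * Y y) +
         Im (Gam y) * Im (2 * k * Gam y - (q y)%:C * Y y)).
  move=> xy yr; have := nY y xy yr; rewrite /rho.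
  move: (Gam y) (Y y) => g yy hY.
  have -> : 2 * (Re g * Re (2 * k * g - (q y)%:C * yy) + Im g * Im (2 * k * g -
    (q y)%:C * yy)) =
     4 * Re k * nsq g - q y * (2 * (Re g * Re yy + Im g * Im yy)).
    by rewrite /nsq !ReImE /=; ring.
  rewrite lerD2l lerN2 (le_trans (ler_norm _))// normrM ler_wpM2l//.
  apply: (@le_trans _ _ (nsq g + nsq yy)); last by rewrite lerD2l.
  rewrite ler_norml /nsq; apply/andP; split.
    by have := sqr_ge0 (Re g + Re yy); have := sqr_ge0 (Im g + Im yy); lra.
  by have := sqr_ge0 (Re g - Re yy); have := sqr_ge0 (Im g - Im yy); lra.
have rho1 : rho (x + r) <= 2 + 8 * nsq k / Im k ^+ 2.
  have -> : rho (x + r) = nsq (1 + 2 * k * (u (x + r) * (w (x + r))^-1)).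
    rewrite /rho /Gam; congr nsq.
    have := w0 (x + r) xr (lexx _); have -> : v (x + r) = w (x + r) + 2 * k * u
      (x + r).
      by rewrite /w /v; ring.
    by move: (w _) (u _) => w' u' w'0; field.
  have par (y : R[i]) : nsq (1 + y) <= 2 * (1 + nsq y).
    rewrite /nsq !ReImE /=; have := sqr_ge0 (1 - Re y); have := sqr_ge0 (Im y); lra.
  apply: le_trans (par _) _; rewrite nsqM nsq2.
  have := uw (x + r) xr (lexx _).
  move=> /(ler_wpM2l (ltW n0)); lra.
have dE := acd_expR (acdB dG (acdZ (4 * Re k) (acdB (acd_id x (x + r)) (acd_cst
  _ _ x)))).
(* The second summand compensates the term |q| b2, since its exponential dominates the integrating
   factor. *)
have dF := acdD (acdM drho dE) (acdZ b2 (acd_expR dG)).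
have := acd_ndecr xr dF; rewrite -/(rho _).
set Q' := (forall x, _); suff : Q'.
  move=> + H => /H {H}; rewrite subrr mulr0 subr0 (addrC x r) addrK (addrC r x)
    => H.
  have e1 : expR (G (x + r) - 4 * Re k * r) <= expR (G x) * expR Q * (4 / (4 *
    Re k * r) ^+ 2).
    rewrite -expRD expRD ler_pM ?expR_ge0//.
      by rewrite ler_expR; lra.
    by apply: expRN_le_sqrV; rewrite !mulr_gt0.
  have e2 : expR (G (x + r)) <= expR (G x) * expR Q by rewrite -expRD ler_expR; lra.
  have H2 : rho x <= expR Q * (rho (x + r) * (4 / (4 * Re k * r) ^+ 2) + b2).
    rewrite -(ler_pM2r (expR_gt0 (G x))).
    have h1 : rho (x + r) * expR (G (x + r) - 4 * Re k * r) <=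
              rho (x + r) * (expR (G x) * expR Q * (4 / (4 * Re k * r) ^+ 2)).
      by rewrite ler_wpM2l// nsq_ge0.
    have h2 : b2 * expR (G (x + r)) <= b2 * (expR (G x) * expR Q) by rewrite
      ler_wpM2l.
    have h3 : 0 <= b2 * expR (G x) by rewrite mulr_ge0// expR_ge0.
    rewrite /rho /Gam /v in H h1 h2 *; lra.
  have sn0 : 0 < s ^+ 2 * nsq k by rewrite mulr_gt0// exprn_gt0.
  have b2n : b2 * nsq k <= 4 / s ^+ 4.
    have h : (s ^+ 2 * nsq k) ^+ 2 <= (Im k ^+ 2) ^+ 2.
      by rewrite ler_sqr ?nnegrE// ltW.
    have s40 : 0 < s ^+ 4 by rewrite exprn_gt0.
    have k40 : 0 < (Im k ^+ 2) ^+ 2 by rewrite exprn_gt0.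
    rewrite ler_pdivlMr//.
    have -> : b2 * nsq k * s ^+ 4 = 4 * (s ^+ 2 * nsq k) ^+ 2 / (Im k ^+ 2) ^+ 2.
      by rewrite /b2; ring.
    by rewrite ler_pdivrMr//; lra.
  have k4 : 4 / (4 * Re k * r) ^+ 2 * nsq k <= (4 * s ^+ 2 * r ^+ 2)^-1.
    have rk : 0 < Re k * r by rewrite mulr_gt0.
    have -> : 4 / (4 * Re k * r) ^+ 2 * nsq k = nsq k / (4 * Re k ^+ 2 * r ^+ 2).
      by field; rewrite !gt_eqF.
    rewrite ler_pdivrMr ?mulr_gt0 ?exprn_gt0// mulrC ler_pdivlMr ?mulr_gt0
      ?exprn_gt0//.
    have := ler_wpM2r (ltW (exprn_gt0 2 r0)) skr; lra.
  have r1 : rho (x + r) <= 2 + 8 / s ^+ 2.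
    apply: le_trans rho1 _; rewrite lerD2l ler_pdivrMr// mulrAC ler_pdivlMr
      ?exprn_gt0//; lra.
  have r10 : 0 <= rho (x + r) by exact: nsq_ge0.
  rewrite -[leLHS]/(rho x * nsq k).
  have h1 := ler_wpM2r (ltW n0) H2.
  apply: le_trans h1 _.
  have h2 : rho (x + r) * (4 / (4 * Re k * r) ^+ 2 * nsq k) <=
            (2 + 8 / s ^+ 2) * (4 * s ^+ 2 * r ^+ 2)^-1.
    apply: ler_pM => //; apply: mulr_ge0; last exact: ltW.
    by apply: divr_ge0 => //; exact: sqr_ge0.
  have h3 : 0 <= expR Q by exact: expR_ge0.
  have := ler_wpM2l h3 (lerD h2 b2n); lra.
move=> y /andP[xy yr]; have := rho'E y (ltW xy) (ltW yr); rewrite -/(rho y).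
set R' := 2 * (_ + _); set e := expR (_ - _); set e' := expR (G y) => hR.
have e0 : 0 < e by exact: expR_gt0.
have ee : e <= e'.
  rewrite ler_expR gerBl mulr_ge0 ?subr_ge0 ?(ltW xy)//.
  by rewrite mulr_ge0// ltW.
have h1 : e * (4 * Re k * rho y - `|q y| * (rho y + b2)) <= e * R' by rewrite
  ler_pM2l.
have h2 : b2 * `|q y| * e <= b2 * `|q y| * e' by rewrite ler_wpM2l// mulr_ge0.
lra.
Qed.

End estimates.

(** * Bounds on m for large and for moderate kappa *)

Section m_bounds.
Context {R : realType}.
Local Notation mu := (@lebesgue_measure R).
Local Notation Re := complex.Re.
Local Notation Im := complex.Im.
Implicit Types (q : R -> R) (z k : R[i]) (u p v w : R -> R[i]) (c d x : R) (b :
  \bar R).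

Lemma nsq1 : nsq (1 : R[i]) = 1.
Proof. by rewrite /nsq /= expr1n expr0n addr0. Qed.

(** [A2] is the square of a bound for |k Gamma|. Of the factor 16, one 4 comes from nsq (2 k) and
    one from nsq (Gamma - 1) >= 1 / 4. *)
Lemma reflection_small (u p k : R[i]) (A2 : R) : u != 0 -> k != 0 ->
  p - k * u != 0 ->
  nsq ((p + k * u) / (p - k * u)) * nsq k <= A2 -> 4 * A2 <= nsq k ->
  nsq (p / u + k) <= 16 * A2.
Proof.
move=> u0 k0 w0; have n0 : 0 < nsq k by rewrite nsq_gt0.
have k20 : 2 * k != 0 by rewrite mulf_neq0// pnatr_eq0.
set g := _ / _ => gA Ak.
have g4 : nsq g <= 4^-1.
  by rewrite -(ler_pM2r n0); lra.
have g1 : 4^-1 <= nsq (g - 1).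
  rewrite [nsq (g - 1)](_ : _ = (1 - Re g) ^+ 2 + Im g ^+ 2); last first.
    by rewrite /nsq !ReImE /=; ring.
  have := sqr_ge0 (Im g); move: g4; rewrite /nsq;
    move: (Re g) (Im g ^+ 2) => a y g4 y0.
  have a2 : a <= 2^-1 by nra.
  have : 2^-1 * 2^-1 <= (1 - a) * (1 - a) by rewrite ler_pM//; lra.
  by rewrite -expr2; lra.
have gE : g - 1 = 2 * k * u / (p - k * u) by rewrite /g; field.
have -> : p / u + k = g * (2 * k) / (g - 1).
  by rewrite gE /g; field; rewrite u0 k0 w0.
have g10 : g - 1 != 0 by rewrite -nsq_gt0; lra.
rewrite nsqM nsqV// nsqM ler_pdivrMr; last by lra.
have -> : nsq (2 * k) = 4 * nsq k by rewrite /nsq !ReImE /=; ring.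
have A0 : 0 <= A2 by apply: le_trans gA; rewrite mulr_ge0 ?nsq_ge0.
have := ler_wpM2l (_ : 0 <= 16 * A2) g1; rewrite mulr_ge0// => /(_ isT); lra.
Qed.

(* If [u x] is small compared to [p x = 1], then [Re u] grows linearly to the
   right of [x], which forces the flux at [x] to be bounded from below. *)
Lemma flux_lower_bound q b z u p x r (G : R -> R) Q B zeta eta :
  0 < r -> in_itv0 b x -> in_itv0 b (x + r) -> 0 <= Q -> 0 <= B ->
  `|Re z| <= B -> `|Im z| <= B -> 0 < zeta -> zeta <= Im z ->
  local_solution q b z u p ->
  acd x (x + r) G (fun y => `|q y|) -> G (x + r) - G x <= Q ->
  (forall y, x <= y -> y <= x + r -> 0 < flux u p y) ->
  p x = 1 ->
  let M := 2 * expR (Q + (1 + 2 * B) * r) in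
  let L := Q + 2 * B * r in
  eta = (4 * L * M + r^-1)^-1 ->
  Num.min 1 (Num.min (4 * L + 1)^-1 (Num.min (eta / 8) (zeta * eta ^+ 3 / 64)))
    <= normc (u x).
Proof.
move=> r0 xb xrb Q0 B0 zr zi zeta0 zetaz su dG GQ fl px1 M L etaE.
have iM : 1 <= expR (Q + (1 + 2 * B) * r).
  rewrite -[leLHS]expR0 ler_expR.
  by have := mulr_ge0 B0 (ltW r0); lra.
have M2 : 2 <= M by rewrite /M; lra.
have L0 : 0 <= L by rewrite addr_ge0// !mulr_ge0// ltW.
have LM0 : 0 <= 4 * L * M by rewrite !mulr_ge0//; lra.
have rV : 0 < r^-1 by rewrite invr_gt0.
have eta0 : 0 < eta by rewrite etaE invr_gt0; lra.
have etaV : eta^-1 = 4 * L * M + r^-1 by rewrite etaE invrK.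
have etar : eta <= r by rewrite -[r]invrK etaE lef_pV2 ?posrE; lra.
(* T = tau + M eta will bound the components of u on [x, x + eta], and the change of Re p there is
   at most L T. Together with tau < 1 / (4 L + 1) this gives L T <= 1 / 2, so Re p stays above 1 /
   2. *)
have etaLM : L * (M * eta) <= 4^-1.
  have : eta * eta^-1 = 1 by rewrite divff// gt_eqF.
  have : 0 <= eta * r^-1 by rewrite mulr_ge0// ltW.
  rewrite etaV; lra.
have ME : M = 2 * expR (Q + (1 + 2 * B) * r) by [].
have LE : L = Q + 2 * B * r by [].
clearbody M L; clear etaE etaV iM LM0 rV.
set tau := normc (u x).
have tau0 : 0 <= tau by rewrite /tau normcE sqrtr_ge0.
rewrite leNgt; apply/negP; rewrite !lt_min => /and4P[t1 t2 t3 t4].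
have nu : nsq (u x) <= 1.
  by rewrite -sqr_normc -/tau exprn_ile1// ltW.
have late : [/\ tau < eta / 8, tau < zeta * eta ^+ 3 / 64, 0 < zeta & zeta <= Im z].
  by split.
clear t1 t3 t4 zeta0 zetaz.
have ztime c d : x <= c -> c <= d -> d <= x + r -> in_itv0 b c /\ in_itv0 b d.
  move=> xc cd dr; have [x0 _] := xb; split; apply: (in_itv0W xrb); lra.
have [du dp] := su _ _ xb xrb.
have G0 t : x <= t -> t <= x + r -> G x <= G t /\ G t <= G (x + r).
  move=> xt tr; split.
    by apply: (acd_ndecr xt (acd_sub (lexx _) tr dG)) => y _.
  by apply: (acd_ndecr tr (acd_sub xt (lexx _) dG)) => y _.
have pM t : x <= t -> t <= x + r -> nsq (p t) <= M.
  move=> xt tr; have [_ tb] := ztime x t (lexx _) xt tr.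
  have [H _] := energy_gronwall su xb tb xt (acd_sub (lexx _) tr dG).
  have np := nsq_ge0 (u t); have [_ Gt] := G0 t xt tr.
  apply: (@le_trans _ _ (nsq (u t) + nsq (p t))); first by rewrite lerDr.
  apply: le_trans H _; rewrite px1 nsq1.
  have h1 : nsq (u x) + 1 <= 2 by lra.
  have h2 : (1 + `|Re z| + `|Im z|) * (t - x) <= (1 + 2 * B) * r.
    have := normr_ge0 (Re z); have := normr_ge0 (Im z) => ? ?.
    by apply: ler_pM; lra.
  have := nsq_ge0 (u x) => nux; rewrite ME; apply: ler_pM h1 _; first by lra.
    exact: expR_ge0.
  rewrite ler_expR.
  by apply: lerD h2; lra.
(* As M >= 1, a bound M on the square also bounds the components. *)
have pM' t : x <= t -> t <= x + r -> `|Re (p t)| <= M /\ `|Im (p t)| <= M.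
  move=> xt tr; have := pM t xt tr; rewrite /nsq => H.
  have := sqr_ge0 (Re (p t)); have := sqr_ge0 (Im (p t)) => ? ?.
  by split; rewrite ler_norml; apply/andP; split; nra.
have rtau : `|Re (u x)| <= tau := normr_Re_le _.
have itau : `|Im (u x)| <= tau := normr_Im_le _.
have ub t : x <= t -> t <= x + eta ->
    `|Re (u t)| <= tau + M * eta /\ `|Im (u t)| <= tau + M * eta.
  move=> xt te; have tr : t <= x + r by lra.
  have Mt : M * (t - x) <= M * eta by rewrite ler_wpM2l//; lra.
  have [dur dui] := acdC_sub (lexx _) tr du.
  have Hr := acd_lip (M := M) xt dur.
  have Hi := acd_lip (M := M) xt dui.
  have h1 : `|Re (u t) - Re (u x)| <= M * (t - x).
    by apply: Hr => y /andP[xy yt]; have [] := pM' y (ltW xy) (le_trans (ltW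
      yt) tr).
  have h2 : `|Im (u t) - Im (u x)| <= M * (t - x).
    by apply: Hi => y /andP[xy yt]; have [] := pM' y (ltW xy) (le_trans (ltW
      yt) tr).
  have k1 := ler_normD (Re (u t) - Re (u x)) (Re (u x)).
  have k2 := ler_normD (Im (u t) - Im (u x)) (Im (u x)).
  by rewrite !subrK in k1 k2; split; lra.
set T := tau + M * eta in ub.
have T0 : 0 <= T by rewrite addr_ge0// mulr_ge0 ?(ltW eta0)//; lra.
have LT : L * T <= 2^-1.
  have : tau * (4 * L + 1) <= 1.
    have h : 0 < 4 * L + 1 by lra.
    have := ltW t2; rewrite -(ler_pM2r h) mulVf// gt_eqF//.
  have : L * tau * 4 <= tau * (4 * L + 1) by lra.
  by rewrite /T mulrDr; lra.
clear t2.
have pr t : x <= t -> t <= x + eta -> 2^-1 <= Re (p t).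
  move=> xt te; have tr : t <= x + r by lra.
  have [dpr _] := acdC_sub (lexx _) tr dp.
  have := acd_ndecr xt (acdD dpr (acdD (acdZ T (acd_sub (lexx _) tr dG)) (acdZ
    (2 * B * T) (acd_id x t)))).
  set Q' := (forall x, _); suff : Q'.
    move=> + H => /H {H}; rewrite px1 /= => H.
    have [_ Gt] := G0 t xt tr.
    have h1 : T * (G t - G x) <= T * Q by rewrite ler_wpM2l//; lra.
    have h2 : 2 * B * T * (t - x) <= 2 * B * T * r.
      by rewrite ler_wpM2l//; [rewrite !mulr_ge0|lra].
    by move: LT; rewrite LE => LT; lra.
  move=> y /andP[xy yt]; have [ur ui] := ub y (ltW xy) (le_trans (ltW yt) te).
  rewrite [Re (((q y)%:C - z) * u y)](_ : _ =
    q y * Re (u y) - Re z * Re (u y) + Im z * Im (u y)); last first.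
    by rewrite !ReImE /=; ring.
  have h1 : - (`|q y| * T) <= q y * Re (u y).
    rewrite lerNl -mulNr (le_trans (ler_norm _))// normrM normrN ler_wpM2l//.
  have h2 : - (B * T) <= - Re z * Re (u y).
    rewrite mulNr lerN2 (le_trans (ler_norm _))// normrM ler_pM//.
  have h3 : - (B * T) <= Im z * Im (u y).
    rewrite lerNl -mulNr (le_trans (ler_norm _))// normrM normrN ler_pM//.
  lra.
have ulow t : x <= t -> t <= x + eta -> (t - x) / 2 - tau <= Re (u t).
  move=> xt te; have tr : t <= x + r by lra.
  have [dur _] := acdC_sub (lexx _) tr du.
  have := acd_ndecr xt (acdB dur (acdZ 2^-1 (acd_id x t))).
  set Q' := (forall x, _); suff : Q'.
    move=> + H => /H {H} /= H; have := ler_norm (- Re (u x)); rewrite normrN; lra.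
  by move=> y /andP[xy yt]; have := pr y (ltW xy) (le_trans (ltW yt) te); lra.
clear T0 LT LE ME L0 M2 etaLM zr zi GQ Q0 B0.
have [t3 t4 zeta0 zetaz] := late.
(* On this last quarter Re u >= 3 eta / 8 - tau >= eta / 4, so the flux loses at least zeta (eta /
   4)^2 (eta / 4) = zeta eta^3 / 64. It starts at no more than tau, hence would become negative. *)
pose s := x + 3 / 4 * eta; pose t := x + eta.
have xs : x <= s by rewrite /s lerDl mulr_ge0// ltW.
have st : s <= t by rewrite /s /t; lra.
have tr : t <= x + r by rewrite /t; lra.
have [sb tb] := ztime s t xs st tr.
have fx : flux u p x <= tau.
  rewrite /flux px1 mulr1 Im_conjc; have := ler_norm (- Im (u x));
    rewrite normrN; lra.
have z0 : 0 < Im z by lra.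
have f1 : flux u p s <= flux u p x := flux_nincr su (ltW z0) xb sb xs.
have f2 : flux u p t + zeta * (eta / 4) ^+ 2 * t <= flux u p s + zeta * (eta /
  4) ^+ 2 * s.
  apply: (acd_nincr st (acdD (acd_flux su sb tb) (acdZ (zeta * (eta / 4) ^+ 2)
    (acd_id s t)))) => y /andP[sy yt].
  rewrite mulr1 mulNr addrC subr_le0.
  have xy : x <= y by lra.
  have ye : y <= x + eta by move: yt; rewrite /t; lra.
  have := ulow y xy ye => uy.
  have uy4 : eta / 4 <= Re (u y) by move: sy; rewrite /s => sy; lra.
  apply: ler_pM => //; [lra|exact: sqr_ge0|].
  rewrite /nsq; have := sqr_ge0 (Im (u y)); nra.
have ft := fl t (le_trans xs st) tr.
have : zeta * (eta / 4) ^+ 2 * (t - s) = zeta * eta ^+ 3 / 64 by rewrite /t /s;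
  field.
lra.
Qed.

End m_bounds.

(** * Constants and the final estimate *)

Section assembly.
Context {R : realType}.
Local Notation mu := (@lebesgue_measure R).
Local Notation Re := complex.Re.
Local Notation Im := complex.Im.
Implicit Types (q : R -> R) (z k : R[i]) (u p : R -> R[i]) (x : R) (e : endpoint R).

Lemma admissible_integrable q e : admissible q e ->
  forall d, in_itv0 (right_end e) d -> mu.-integrable `]0, d[ (EFin \o q).
Proof.
case: e => [b h [b0 ib]|[lq _]|[lq _ _]|u0 [lq _ _ _ _]] d [d0 db]; try exact: lq.
by apply: integrableS ib => //; apply: subset_itvl; rewrite bnd_simp ltW// -lte_fin.
Qed.

Lemma flux_gt0_admissible q e z u : admissible q e -> 0 < Im z ->
  solves q (right_end e) z u -> nonzero_on (right_end e) u ->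
  boundary_condition e u ->
  forall x, in_itv0 (right_end e) x -> 0 < flux u (deriveC u) x.
Proof.
move=> adm z0 sol nz bc.
have iq := admissible_integrable adm.
apply: (flux_gt0 (solves_local sol) iq z0 nz).
case: e adm sol nz bc iq => [b h|||u0] /=.
- by move=> _ sol _ bc _; exact: (flux_ge0_finite sol z0 bc).
- by move=> [_ nq] sol _ bc iq; exact: (flux_ge0_neg_part iq nq z0 sol bc).
- by move=> [_ _ lp] sol nz bc iq; exact: (flux_ge0_limit_point iq lp z0 sol nz bc).
- move=> [_ lc sol0 nz0 dis] sol _ bc iq.
  by apply: (flux_ge0_limit_circle iq lc _ sol0 nz0 dis z0 sol bc);
    rewrite /= ltr01.
Qed.

Lemma le_window_sup q a delta x r : 0 < r -> r <= delta -> 0 <= x <= a ->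
  mu.-integrable `]0, (a + delta)[ (EFin \o q) ->
  0 <= \int[mu]_(y in `]x, (x + r)[) `|q y| <= window_sup q a delta.
Proof.
move=> r0 rd /andP[x0 xa] iq.
have iaq := integrable_abse iq.
have mono (A B : set R) : measurable A -> measurable B -> A `<=` B ->
    B `<=` `]0, (a + delta)[ ->
    \int[mu]_(y in A) `|q y| <= \int[mu]_(y in B) `|q y|.
  move=> mA mB AB Bad.
  have iB : mu.-integrable B (fun y => (`|q y|)%:E).
    exact: integrableS iaq.
  have iA : mu.-integrable A (fun y => (`|q y|)%:E) by exact: integrableS iB.
  rewrite /Rintegral fine_le//.
  - exact: (@integrable_fin_num _ _ R mu _ mA _ iA).
  - exact: (@integrable_fin_num _ _ R mu _ mB _ iB).
  - by apply: ge0_subset_integral => //; case/integrableP: iB.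
have sub y : 0 <= y -> y <= a -> `]y, (y + delta)[ `<=` `]0, (a + delta)[.
  move=> y0 ya t /=; rewrite !in_itv/= => /andP[yt td].
  by apply/andP; split; lra.
apply/andP; split; first by apply: Rintegral_ge0.
apply: (@le_trans _ _ (\int[mu]_(y in `]x, (x + delta)[) `|q y|)).
  apply: mono => //; last exact: sub.
  by apply: subset_itvl; rewrite bnd_simp lerD2l.
apply: ub_le_sup; last by exists x => //=; rewrite in_itv/= x0.
(* The real [sup] bounds its elements only if the set is bounded above; the integral over (0, a +
   delta) shows that. *)
exists (\int[mu]_(y in `]0, (a + delta)[) `|q y|) => _ [y + <-].
rewrite /= in_itv/= => /andP[y0 ya]; apply: mono => //; exact: sub.
Qed.

(* Bounds [nsq Gamma * nsq k] for the reflection coefficient [Gamma]. *)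
Definition refl_const (s r Q : R) : R :=
  expR Q * ((2 + 8 / s ^+ 2) / (4 * s ^+ 2 * r ^+ 2) + 4 / s ^+ 4).

(* A lower bound for [1 / |m|] when [K0 <= |k|] and [nsq k <= 4 * refl_const]. *)
Definition inv_m_const (K0 s r Q : R) : R :=
  let B := 4 * refl_const s r Q in
  let M := 2 * expR (Q + (1 + 2 * B) * r) in
  let L := Q + 2 * B * r in
  let eta := (4 * L * M + r^-1)^-1 in
  let zeta := 2 * s ^+ 2 * K0 ^+ 2 in
  Num.min 1 (Num.min (4 * L + 1)^-1 (Num.min (eta / 8) (zeta * eta ^+ 3 / 64))).

(** The first summand bounds |m + k| for large |k|; the other two bound |m| and |k| separately for
    moderate |k|. *)
Definition m_const (K0 s r Q : R) : R :=
  Num.sqrt (16 * refl_const s r Q) + (inv_m_const K0 s r Q)^-1 +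
  Num.sqrt (4 * refl_const s r Q).

Lemma refl_const_ge0 s r Q : 0 <= refl_const s r Q.
Proof.
rewrite /refl_const mulr_ge0 ?expR_ge0// addr_ge0//.
  have s2 := sqr_ge0 s; have r2 := sqr_ge0 r.
  apply: divr_ge0; first by apply: addr_ge0 => //; exact: divr_ge0.
  by apply: mulr_ge0 => //; exact: mulr_ge0.
by rewrite divr_ge0// -[4%N]/(2 * 2)%N exprM sqr_ge0.
Qed.

Lemma inv_m_const_gt0 K0 s r Q : 0 < K0 -> 0 < s -> 0 < r -> 0 <= Q ->
  0 < inv_m_const K0 s r Q.
Proof.
move=> K0_gt0 s0 r0 Q0; rewrite /inv_m_const.
set B := 4 * refl_const s r Q; set M := 2 * expR _; set L := Q + _.
have B0 : 0 <= B by rewrite mulr_ge0// refl_const_ge0.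
have L0 : 0 <= L.
  by apply: addr_ge0 => //; apply: mulr_ge0 (ltW r0); exact: mulr_ge0.
have M0 : 0 <= M by apply: mulr_ge0 => //; exact: expR_ge0.
have eta0 : 0 < (4 * L * M + r^-1)^-1.
  rewrite invr_gt0; apply: ltr_wpDl; last by rewrite invr_gt0.
  by apply: mulr_ge0 => //; exact: mulr_ge0.
have L10 : 0 < 4 * L + 1 by lra.
have zeta0 : 0 < 2 * s ^+ 2 * K0 ^+ 2.
  by apply: mulr_gt0; [apply: mulr_gt0 => //|]; exact: exprn_gt0.
rewrite !lt_min ltr01 invr_gt0 L10 divr_gt0//= divr_gt0// mulr_gt0//.
exact: exprn_gt0.
Qed.

Lemma normc_nsq_le (y : R[i]) c : nsq y <= c -> normc y <= Num.sqrt c.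
Proof. by move=> yc; rewrite normcE ler_wsqrtr. Qed.

Lemma m_bound K0 q b k u p x r s (G : R -> R) Q : 0 < K0 -> 0 < s -> 0 < r -> 0
  <= Q ->
  in_itv0 b x -> in_itv0 b (x + r) ->
  s * normc k <= Re k -> s * normc k <= - Im k -> K0 <= normc k ->
  local_solution q b (- k ^+ 2) u p ->
  (forall y, x <= y -> y <= x + r -> 0 < flux u p y) ->
  acd x (x + r) G (fun y => `|q y|) -> G (x + r) - G x <= Q ->
  normc (p x / u x + k) <= m_const K0 s r Q.
Proof.
move=> K0_gt0 s0 r0 Q0 xb xrb kr ki kK su fl dG GQ.
have nk0 : 0 < normc k by exact: lt_le_trans kK.
have n0 : 0 < nsq k by rewrite -sqr_normc exprn_gt0.
have snk : 0 < s * normc k by rewrite mulr_gt0.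
have k0 : k != 0 by rewrite -nsq_gt0.
have xr : x <= x + r by rewrite lerDl ltW.
have fx := fl x (lexx _) xr.
have kr2 : s ^+ 2 * nsq k <= Re k ^+ 2.
  by rewrite -sqr_normc -exprMn ler_sqr ?nnegrE; lra.
have ki2 : s ^+ 2 * nsq k <= Im k ^+ 2.
  by rewrite -sqr_normc -exprMn -[leRHS]sqrrN ler_sqr ?nnegrE; lra.
have kr0 : 0 < Re k by lra.
have ki0 : 0 < - Im k by lra.
have u0 : u x != 0 by apply: contraTneq fx => ux;
  rewrite /flux !ReImE ux /= oppr0 !mul0r addr0 ltxx.
have p0 : p x != 0 by apply: contraTneq fx => px;
  rewrite /flux !ReImE px /= !mulr0 addr0 ltxx.
have w0 : p x - k * u x != 0.
  apply: contraTneq fx => w0; have -> : flux u p x = Im (conjc (u x) * (p x - k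
    * u x)) + Im k * nsq (u x).
    by rewrite /flux !ReImE /nsq; ring.
  rewrite w0 mulr0 /= add0r -leNgt mulr_le0_ge0 ?nsq_ge0//; lra.
have refl := @reflection_bound R q b k u p x r s G Q s0 r0 xb xrb kr0 ki0 kr2
  ki2 su fl dG GQ.
rewrite -/(refl_const s r Q) in refl.
have tau0 := inv_m_const_gt0 K0_gt0 s0 r0 Q0.
have [An|nA] := leP (4 * refl_const s r Q) (nsq k).
  have := normc_nsq_le (reflection_small u0 k0 w0 refl An).
  move=> /le_trans; apply; rewrite /m_const -addrA lerDl addr_ge0 ?sqrtr_ge0//.
  by rewrite invr_ge0 ltW.
rewrite (le_trans (le_normcD _ _))// /m_const lerD//; last first.
  by apply: normc_nsq_le; exact: ltW.
rewrite (@le_trans _ _ (inv_m_const K0 s r Q)^-1) ?lerDr ?sqrtr_ge0//.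
(* Scaling the solution by h makes its derivative at x equal to 1 and multiplies the flux by |h|^2,
   so positivity is kept. *)
pose h := (p x)^-1.
have suh : local_solution q b (- k ^+ 2) (fun y => h * u y) (fun y => h * p y).
  move=> c d cb db; have [du dp] := su c d cb db; split; first exact: acdCZ.
  by apply: (acdC_eq (acdCZ h dp)) => y _; ring.
have flh y : x <= y -> y <= x + r -> 0 < flux (fun y => h * u y) (fun y => h *
  p y) y.
  move=> xy yr; rewrite (_ : flux _ _ y = nsq h * flux u p y).
    by rewrite mulr_gt0 ?fl// nsq_gt0 invr_eq0.
  by rewrite /flux !ReImE /nsq; ring.
have B0 : 0 <= 4 * refl_const s r Q by rewrite mulr_ge0// refl_const_ge0.
have zr : `|Re (- k ^+ 2)| <= 4 * refl_const s r Q.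
  apply: le_trans (ltW nA); rewrite expr2 !ReImE /nsq ler_norml.
  by have := sqr_ge0 (Re k); have := sqr_ge0 (Im k) => ? ?; apply/andP; split; lra.
have ziE : Im (- k ^+ 2) = 2 * (Re k * - Im k) by rewrite expr2 !ReImE; ring.
have zi : `|Im (- k ^+ 2)| <= 4 * refl_const s r Q.
  apply: le_trans (ltW nA); rewrite ziE ger0_norm; last by rewrite !mulr_ge0// ltW.
  by rewrite /nsq; have := sqr_ge0 (Re k + Im k); lra.
have zeta0 : 0 < 2 * s ^+ 2 * K0 ^+ 2 by rewrite !mulr_gt0// exprn_gt0.
have zetaz : 2 * s ^+ 2 * K0 ^+ 2 <= Im (- k ^+ 2).
  rewrite ziE -mulrA ler_pM2l//.
  have h1 : (s * normc k) * (s * normc k) <= Re k * - Im k by rewrite ler_pM// ltW.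
  have h2 : s * K0 <= s * normc k by rewrite ler_pM2l.
  have h3 : (s * K0) * (s * K0) <= (s * normc k) * (s * normc k).
    by rewrite ler_pM// mulr_ge0// ltW.
  lra.
have h1 : h * p x = 1 by rewrite mulVf.
have := flux_lower_bound r0 xb xrb Q0 B0 zr zi zeta0 zetaz suh dG GQ flh h1 erefl.
rewrite -/(inv_m_const K0 s r Q) => low.
have -> : normc (p x / u x) = (normc (h * u x))^-1.
  by rewrite -normcV invfM invrK.
by rewrite lef_pV2 ?posrE// (lt_le_trans tau0).
Qed.

(** Re k / |k| = sin (theta + pi / 2) and - Im k / |k| = sin (- theta), with both angles in (eps, pi
    / 2), where the sine increases. *)
Lemma sector_bounds (k : R[i]) theta eps : 0 < eps -> is_arg k theta ->
  - (pi / 2) + eps < theta < - eps ->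
  [/\ 0 < sin eps, sin eps * normc k <= Re k & sin eps * normc k <= - Im k].
Proof.
move=> e0 [k0 _ kE] /andP[t1 t2].
have pi0 : 0 < pi :> R := pi_gt0 R.
have nk : 0 <= normc k by rewrite normcE sqrtr_ge0.
have s0 : 0 < sin eps by apply: sin_gt0_pi; apply/andP; split; lra.
have mono (y : R) : eps < y -> y < pi / 2 -> sin eps <= sin y.
  by move=> ey yp; rewrite ltW// ltr_sin// in_itv/=; apply/andP; split; lra.
split => //; rewrite {2}kE /=.
- rewrite mulrC ler_wpM2l//; have := mono (theta + pi / 2).
  by rewrite sinDpihalf; apply; lra.
- rewrite mulrC -mulrN ler_wpM2l// -sinN; apply: mono; lra.
Qed.

End assembly.

Theorem theorem1p4 (R : realType) (K0 : R) (hK0 : 0 < K0) :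
  exists C : R -> R -> R -> R,
  forall (a delta eps : R) (q : R -> R) (e : endpoint R) (m : R[i] -> R -> R[i]),
    0 < a -> 0 < delta -> 0 < eps ->
    (@lebesgue_measure R).-integrable `]0, (a + delta)[ (EFin \o q) ->
    ((a + delta)%:E <= right_end e)%E ->
    admissible q e ->
    is_m_function q e m ->
    forall (kappa : R[i]) (theta : R),
      is_arg kappa theta -> - (pi / 2) + eps < theta < - eps ->
      K0 <= normc kappa ->
      forall x : R, 0 <= x <= a ->
        normc (m (- kappa ^+ 2) x + kappa) <=
          C eps delta (window_sup q a delta).
Proof.
(* For x <= a the point x + delta / 2 is strictly below a + delta <= b, so the solution is
   controlled up to it. *)
exists (fun eps delta Q => m_const K0 (sin eps) (delta / 2) Q).
move=> a delta eps q e m a0 d0 e0 iq ab adm mm k theta karg kth kK.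
have [s0 kr ki] := sector_bounds e0 karg kth.
set Q := window_sup q a delta.
have r0 : 0 < delta / 2 by rewrite divr_gt0.
have nk0 : 0 < normc k by exact: lt_le_trans kK.
have sk0 : 0 < sin eps * normc k by rewrite mulr_gt0.
have z0 : 0 < complex.Im (- k ^+ 2).
  have -> : complex.Im (- k ^+ 2) = 2 * (complex.Re k * - complex.Im k).
    by rewrite expr2 !ReImE; ring.
  by rewrite mulr_gt0// mulr_gt0; lra.
have [u [sol nz bc mE m0]] := mm _ z0.
have fl := flux_gt0_admissible adm z0 sol nz bc.
have inb x : 0 < x -> x < a + delta -> in_itv0 (right_end e) x.
  by move=> x0 xa; split => //; apply: lt_le_trans ab; rewrite lte_fin.
have pos x : 0 < x -> x <= a -> normc (m (- k ^+ 2) x + k) <= m_const K0 (sin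
  eps) (delta / 2) Q.
  move=> x0 xa; have xb : in_itv0 (right_end e) x by apply: inb => //; lra.
  have xrb : in_itv0 (right_end e) (x + delta / 2) by apply: inb; lra.
  have xa' : 0 <= x <= a by rewrite ltW.
  have rd : delta / 2 <= delta by lra.
  have /andP[I0 IQ] := le_window_sup r0 rd xa' iq.
  have [G dG GE] := primitive_absq (admissible_integrable adm) xb xrb.
  rewrite mE//; apply: (m_bound (G := G) hK0 s0 r0 _ xb xrb kr ki kK
    (solves_local sol) _ dG).
  - exact: le_trans IQ.
  - move=> y xy yr; apply: fl; apply: inb; lra.
  - by rewrite GE// lerDl ltW.
(* At x = 0 the value of m is its limit from the right, and the bound |m + k|^2 <= C^2 passes to the
   limit. *)
move=> x /andP[x0 xa]; move: x0; rewrite le_eqVlt => /predU1P[<-|x0];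
  last exact: pos.
set C := m_const _ _ _ _ in pos *.
have C0 : 0 <= C by apply: le_trans (pos a a0 (lexx _)); rewrite normcE sqrtr_ge0.
have [mr mi] := m0.
have lim : (complex.Re (m (- k ^+ 2) y) + complex.Re k) * (complex.Re (m (- k
  ^+ 2) y) + complex.Re k) +
           (complex.Im (m (- k ^+ 2) y) + complex.Im k) * (complex.Im (m (- k
             ^+ 2) y) + complex.Im k)
   @[y --> 0^'+] --> (complex.Re (m (- k ^+ 2) 0) + complex.Re k) * (complex.Re
     (m (- k ^+ 2) 0) + complex.Re k) +
           (complex.Im (m (- k ^+ 2) 0) + complex.Im k) * (complex.Im (m (- k
             ^+ 2) 0) + complex.Im k).
  by apply: cvgD; apply: cvgM; apply: cvgD => //; exact: cvg_cst.
have : nsq (m (- k ^+ 2) 0 + k) <= C ^+ 2.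
  rewrite /nsq !ReImE !expr2; apply: (cvgr_to_le lim).
  near=> y; have y0 : 0 < y by near: y; exact: nbhs_right_gt.
  have ya : y <= a by apply: ltW; near: y; exact: nbhs_right_lt.
  have := pos y y0 ya; set mm' := m _ _ => H.
  have : nsq (mm' + k) <= C ^+ 2.
    by rewrite -sqr_normc ler_sqr ?nnegrE// normcE sqrtr_ge0.
  by rewrite /nsq !ReImE !expr2.
by move=> /normc_nsq_le; rewrite sqrtr_sqr ger0_norm.
Unshelve. all: by end_near. Qed.
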